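(* Let $t\in\mathbb{C}$ with $t\neq0$ and $t^3+27\neq0$, and let $F(x,y,z)=x^3+y^3+z^3+txyz$. Put $\epsilon=\frac{1+i\sqrt3}{2}$, and let $$a(t)=\frac{\sqrt[3]{3}\cdot\sqrt[3]{\sqrt3\sqrt{t^3+27}-9}}{3}$$ for a fixed choice of the roots. For $k\in\{0,1,2\}$ set $$z_1(\epsilon^{2k}t)=a(t)-\frac{\epsilon^{2k}t}{3a(t)},\quad z_2(\epsilon^{2k}t)=\frac{\epsilon^{2k+1}t}{3a(t)}-\epsilon^5a(t),\quad z_3(\epsilon^{2k}t)=\frac{\epsilon^{2k+5}t}{3a(t)}-\epsilon\,a(t),$$ which are the three solutions of $z^3+\epsilon^{2k}tz+2=0$. Then the sextactic points of the plane cubic curve $F=0$ are exactly the $27$ points $$(1:\epsilon^{2k}:z_j(\epsilon^{2k}t)),\qquad (1:z_j(\epsilon^{2k}t):\epsilon^{2k}),\qquad (z_j(\epsilon^{2k}t):\epsilon^{2k}:1),$$ with $k\in\{0,1,2\}$ and $j\in\{1,2,3\}$.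
   Context: The curve is considered in the complex projective plane $\mathbb{P}^2$ with homogeneous coordinates $x,y,z$. Let $C$ be a plane curve and $P$ a point of $C$ that is neither a singular point nor an inflection point. The osculating conic $O_P$ of $C$ at $P$ is the conic meeting $C$ at $P$ with intersection multiplicity at least $5$. The point $P$ is called sextactic if the intersection multiplicity of $C$ and $O_P$ at $P$ is at least $6$. The cube roots of unity are $1,\epsilon^2,\epsilon^4=-\epsilon$. The values $z_j(\epsilon^{2k}t)$ all use the same value $a(t)$. *)

(* Defs.v *)
From mathcomp Require Export all_boot all_order all_algebra fraction.
From mathcomp Require Export mpoly.
From mathcomp Require Export complex reals.

Set Implicit Arguments.
Unset Strict Implicit.
Unset Printing Implicit Defensive.

Import GRing.Theory Num.Theory.
Local Open Scope ring_scope.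

(* Points of the projective plane over C are given by nonzero row vectors of
   homogeneous coordinates, up to [proj_eq]; a curve is given by a homogeneous
   polynomial in the three variables 'X_0, 'X_1, 'X_2 (i.e. x, y, z). *)
Section PlaneCurves.
Variable C : fieldType.
Implicit Types (P Q : 'rV[C]_3) (F G L A B : {mpoly C[3]}).
Implicit Types (h a b : {fraction {mpoly C[3]}}).

Definition hpoint (x y z : C) : 'rV[C]_3 := \row_(i < 3) [:: x; y; z]`_i.

Definition proj_eq P Q : Prop := exists2 c : C, c != 0 & Q = c *: P.

Definition eval_at P F : C := F.@[P 0].

(* The local ring of the projective plane at P, inside the field of fractions
   of the homogeneous coordinate ring. *)
Definition in_local_ring P h : Prop :=
  exists (d : nat) A B,
    [/\ A \is d.-homog, B \is d.-homog, eval_at P B != 0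
      & h = tofrac A / tofrac B].

(* F divided by a power of the linear form L, as an element of degree 0; for F
   homogeneous and nonzero, [(msize F).-1] is the degree of F. *)
Definition dehomog L F : {fraction {mpoly C[3]}} :=
  tofrac F / tofrac L ^+ (msize F).-1.

(* The ideal generated by (local equations of) F and G in the local ring at P.
   It does not depend on the linear form L chosen with L(P) <> 0, since two
   choices change the generators by units. *)
Definition in_local_ideal F G P h : Prop :=
  exists L a b,
    [/\ L \is 1.-homog, eval_at P L != 0,
        in_local_ring P a, in_local_ring P b
      & h = a * dehomog L F + b * dehomog L G].

(* The intersection multiplicity of F and G at P is the dimension over C of the
   quotient of the local ring at P by the ideal (F, G). It is at least n iff
   the local ring contains n elements that are linearly independent modulo this
   ideal. *)
Definition intersection_mult_ge (n : nat) F G P : Prop :=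
  exists h : 'I_n -> {fraction {mpoly C[3]}},
    (forall i, in_local_ring P (h i)) /\
    (forall c : 'I_n -> C,
       in_local_ideal F G P (\sum_(i < n) tofrac (c i)%:MP * h i) ->
       forall i, c i = 0).

Definition on_curve F P : Prop := eval_at P F = 0.

Definition singular_point F P : Prop :=
  on_curve F P /\ forall i : 'I_3, eval_at P F^`M(i) = 0.

Definition tangent_line F P : {mpoly C[3]} :=
  \sum_(i < 3) eval_at P F^`M(i) *: 'X_i.

Definition inflection_point F P : Prop :=
  [/\ on_curve F P, ~ singular_point F P
    & intersection_mult_ge 3 F (tangent_line F P) P].

Definition conic G : Prop := G != 0 /\ G \is 2.-homog.

(* At a point of the curve that is neither singular nor an inflection point
   there is exactly one such conic, up to a scalar factor of its equation. *)
Definition osculating_conic F P G : Prop :=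
  conic G /\ intersection_mult_ge 5 F G P.

Definition sextactic_point F P : Prop :=
  [/\ on_curve F P, ~ singular_point F P, ~ inflection_point F P
    & exists2 G, osculating_conic F P G & intersection_mult_ge 6 F G P].

Definition cubic_F (t : C) : {mpoly C[3]} :=
  let x := 'X_(inord 0) in let y := 'X_(inord 1) in let z := 'X_(inord 2) in
  x ^+ 3 + y ^+ 3 + z ^+ 3 + t *: (x * y * z).

End PlaneCurves.

Section Points.
Variable C : numClosedFieldType.

Definition eps : C := (1 + 'i * sqrtC 3) / 2.

(* [z_sol t a k j] is z_{j+1}(eps^{2k} t), with a standing for a(t). *)
Definition z_sol (t a : C) (k j : 'I_3) : C :=
  [:: a - eps ^+ (2 * k) * t / (3 * a);
      eps ^+ (2 * k + 1) * t / (3 * a) - eps ^+ 5 * a;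
      eps ^+ (2 * k + 5) * t / (3 * a) - eps * a]`_j.

(* [m] selects one of the three families of nine points. *)
Definition sextactic_candidate (t a : C) (m k j : 'I_3) : 'rV[C]_3 :=
  let e := eps ^+ (2 * k) in
  let z := z_sol t a k j in
  nth 0 [:: hpoint 1 e z; hpoint 1 z e; hpoint z e 1] m.

End Points.

(* Main.v *)
From HB Require Import structures.
Require Import Defs.
From mathcomp Require Import ring.
Import GRing.Theory Num.Theory.
Local Open Scope ring_scope.
Set Implicit Arguments.
Unset Strict Implicit.
Unset Printing Implicit Defensive.

(** Contact along a branch. At a smooth point P of a plane curve F = 0 a chart
    consists of linear forms L, M, T with L = 1 and M = T = 0 at P, where T = 0
    is the tangent, and of a polynomial arc on which L = 1, M = X, T = O(X^2)
    and which satisfies F up to order n. In the local ring at P the maximal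
    ideal is generated by F and M/L, so every element is, modulo F, a polynomial
    in M/L up to any given order. Hence the intersection multiplicity of F and G
    at P is at least k if and only if G vanishes to order k on the arc
    ([intersection_mult_geP]); this turns all contact conditions into conditions
    on power series. Charts exist by Newton's method ([chart_exists]).

    Flexes. For F = x^3 + y^3 + z^3 + t xyz with t^3 + 27 <> 0, the Hessian
    determinant equals 8 (t^3 + 27) xyz on the curve. It vanishes at Q as soon
    as F = N G + k T^3 with linear forms N and T that vanish at Q
    ([flex_coordinates]), so the flexes lie on xyz = 0; the converse follows from
    an explicit identity of this shape ([hesse_flex_identity]).

    Sextactic points. Let P be a smooth point of the cubic that is not a flex, T
    its tangent, and Q the third intersection of T with the cubic. The divisor
    of T is 2P + Q, so a conic G has divisor 6P exactly when the divisor of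
    T^3 / G is 3Q, that is when Q is a flex. Algebraically, the contact of order
    6 forces F = N G + k T^3 after a scaling of G, because the monomials in L, M, T
    left after a division by G have the distinct orders 0, 1, 2, 3, 4, 5, 6 on
    the arc ([cubic_pencil]); then N vanishes at Q, and Q is a flex. As
    Q = (x (y^3 - z^3) : y (z^3 - x^3) : z (x^3 - y^3)), two of the cubes x^3,
    y^3, z^3 agree ([sextactic_cubes]). Conversely, if x^3 = y^3, then the flex
    tangent N at Q = (x : -y : 0) is explicit, and so is a conic G with N G a
    combination of F and T^3 ([contact_identity]); as N does not vanish at P, the
    contact of G is 6 ([candidate_sextactic]).

    Scaling one of two coordinates with equal cubes to 1 makes the other one a
    cube root of unity e, and the equation of the cubic becomes
    z^3 + e t z + 2 = 0, which Cardano's formula solves. *)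

(** * Forms and their values along an arc *)

Section Evaluation.
Variable C : fieldType.
Implicit Types (p A B F G L : {mpoly C[3]}) (P : 'rV[C]_3).
Implicit Types (g : 'I_3 -> {poly C}).

Lemma mpoly_ring_ind (Q : {mpoly C[3]} -> Prop) :
  (forall c, Q c%:MP) -> (forall i, Q 'X_i) ->
  (forall p q, Q p -> Q q -> Q (p + q)) ->
  (forall p q, Q p -> Q q -> Q (p * q)) -> forall p, Q p.
Proof.
move=> QC QX QD QM; elim/mpolyind => [|c m p _ _ IH]; first by rewrite -mpolyC0.
apply: (QD) => //; rewrite -mul_mpolyC; apply: (QM) => //.
rewrite mpolyXE_id; apply: big_ind => [||i _]; [exact: (QC 1) | exact: QM | ].
by elim: (m i) => [|k IHk]; [exact: (QC 1) | rewrite exprS; apply: QM].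
Qed.

HB.instance Definition _ P := GRing.RMorphism.copy (eval_at P) (meval (P 0)).

Lemma eval_atD P A B : eval_at P (A + B) = eval_at P A + eval_at P B.
Proof. exact: rmorphD. Qed.
Lemma eval_atN P A : eval_at P (- A) = - eval_at P A.
Proof. exact: rmorphN. Qed.
Lemma eval_atM P A B : eval_at P (A * B) = eval_at P A * eval_at P B.
Proof. exact: rmorphM. Qed.
Lemma eval_atXn P A k : eval_at P (A ^+ k) = eval_at P A ^+ k.
Proof. exact: rmorphXn. Qed.
Lemma eval_atC P c : eval_at P c%:MP = c. Proof. exact: mevalC. Qed.
Lemma eval_atZ P c A : eval_at P (c *: A) = c * eval_at P A.
Proof. exact: mevalZ. Qed.
Lemma eval_atX P i : eval_at P 'X_i = P 0 i. Proof. exact: mevalXU. Qed.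

Definition eval_atE := (eval_atXn, eval_atD, eval_atN, eval_atM, eval_atC,
  eval_atZ, eval_atX).

Lemma eval_at_neq0 P A : eval_at P A != 0 -> A != 0.
Proof. by apply: contraNneq => ->; rewrite rmorph0. Qed.

Lemma homogX1 i : ('X_i : {mpoly C[3]}) \is 1.-homog.
Proof. by rewrite dhomogX; apply/eqP/mdeg1. Qed.

Lemma homogCM k d A :
  A \is d.-homog -> k%:MP * A \is d.-homog.
Proof. by move=> hA; rewrite mul_mpolyC dhomogZ. Qed.

Lemma homogB d A B :
  A \is d.-homog -> B \is d.-homog -> A - B \is d.-homog.
Proof. by move=> hA hB; rewrite dhomogD // dhomogN. Qed.

Lemma homog1X L k : L \is 1.-homog -> L ^+ k \is k.-homog.
Proof. by move=> hL; have := dhomogMn k hL; rewrite mul1n. Qed.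

Definition along g (A : {mpoly C[3]}) : {poly C} := mmap polyC g A.

HB.instance Definition _ g := GRing.RMorphism.copy (along g) (mmap polyC g).

Lemma alongD g A B : along g (A + B) = along g A + along g B.
Proof. exact: rmorphD. Qed.
Lemma alongN g A : along g (- A) = - along g A.
Proof. exact: rmorphN. Qed.
Lemma alongM g A B : along g (A * B) = along g A * along g B.
Proof. exact: rmorphM. Qed.
Lemma alongXn g A k : along g (A ^+ k) = along g A ^+ k.
Proof. exact: rmorphXn. Qed.
Lemma alongC g c : along g c%:MP = c%:P. Proof. exact: mmapC. Qed.
Lemma alongX g i : along g 'X_i = g i.
Proof. by rewrite /along mmapX mmap1U. Qed.
Lemma alongZ g c A : along g (c *: A) = c *: along g A.
Proof. by rewrite /along mmapZ mul_polyC. Qed.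

Definition alongE := (alongXn, alongD, alongN, alongM, alongC, alongZ, alongX).

Lemma along_horner0 g P A :
  (forall i, (g i).[0] = P 0 i) -> (along g A).[0] = eval_at P A.
Proof.
move=> gP; elim/mpoly_ring_ind: A => [c|i|A B IA IB|A B IA IB].
- by rewrite alongC eval_atC hornerC.
- by rewrite alongX eval_atX.
- by rewrite !rmorphD hornerD IA IB.
- by rewrite !rmorphM hornerM IA IB.
Qed.

Lemma along_congr g g' q A :
  (forall i, q %| g i - g' i) -> q %| along g A - along g' A.
Proof.
move=> gg; elim/mpoly_ring_ind: A => [c|i|A B IA IB|A B IA IB].
- by rewrite !alongC subrr dvdp0.
- by rewrite !alongX.
- by rewrite !rmorphD opprD addrACA dvdp_add.
rewrite !rmorphM /=; set a := along g A; set b := along g B.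
rewrite (_ : _ - _ = a * (b - along g' B) + (a - along g' A) * along g' B).
  by apply: dvdp_add; [apply: dvdp_mull | apply: dvdp_mulr].
by rewrite {}/a {}/b; ring.
Qed.

(** Every variable is a combination of L, M and T, so a monomial is a multiple of
    a power of L modulo the ideal (M, T). When M and T vanish at a point and L
    does not, this describes the forms that vanish at the point. *)
Lemma homog_decomp (L M T : {mpoly C[3]}) (a b c : 'I_3 -> C) d A :
  L \is 1.-homog -> M \is 1.-homog -> T \is 1.-homog ->
  (forall i, 'X_i = a i *: L + b i *: M + c i *: T) ->
  A \is d.+1.-homog ->
  exists e A1 A2, [/\ A1 \is d.-homog, A2 \is d.-homog
    & A = e *: L ^+ d.+1 + M * A1 + T * A2].
Proof.
move=> hL hM hT hX hA.
pose Q (B : {mpoly C[3]}) := exists e A1 A2,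
  [/\ A1 \is d.-homog, A2 \is d.-homog
    & B = e *: L ^+ d.+1 + M * A1 + T * A2].
have QD B1 B2 : Q B1 -> Q B2 -> Q (B1 + B2).
  move=> [e [A1 [A2 [h1 h2 ->]]]] [e' [A1' [A2' [h1' h2' ->]]]].
  exists (e + e'), (A1 + A1'), (A2 + A2'); split; rewrite ?dhomogD //.
  by rewrite scalerDl !mulrDr addrACA; congr (_ + _); rewrite addrACA.
have QZ k B : Q B -> Q (k *: B).
  move=> [e [A1 [A2 [h1 h2 ->]]]].
  exists (k * e), (k *: A1), (k *: A2); split; rewrite ?dhomogZ //.
  by rewrite !scalerDr scalerA -!scalerAr.
have QX m : mdeg m = d.+1 -> Q 'X_[m].
  clear hA QD QZ; rewrite /Q; elim: {A Q} d m => [|d IH] m dm.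
    have /eqP/mdeg1P [i /eqP ->] := dm.
    exists (a i), (b i)%:MP, (c i)%:MP; split.
    - by rewrite -(mulr1 (_%:MP)) mul_mpolyC dhomogZ ?dhomog1.
    - by rewrite -(mulr1 (_%:MP)) mul_mpolyC dhomogZ ?dhomog1.
    - by rewrite hX expr1 ![_ * _%:MP]mulrC !mul_mpolyC.
  have [i mi] : exists i, m i != 0%N.
    apply/existsP; apply: contraPT dm => /existsPn m0.
    rewrite mdegE big1 // => i _; apply/eqP; exact: negbNE (m0 i).
  have Em : ((m - U_(i)) + U_(i))%MM = m.
    by apply: submK; rewrite lep1mP.
  have dm' : mdeg (m - U_(i))%MM = d.+1.
    by apply/eqP; rewrite -eqSS -[X in _ == X]dm -[in X in _ == X]Em mdegD mdeg1 addn1.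
  have [e [A1 [A2 [h1 h2 E]]]] := IH _ dm'.
  have hY : ('X_[m - U_(i)] : {mpoly C[3]}) \is d.+1.-homog by rewrite dhomogX; apply/eqP.
  exists (a i * e), (a i *: (L * A1) + b i *: 'X_[m - U_(i)]),
    (a i *: (L * A2) + c i *: 'X_[m - U_(i)]).
  have hLA B : B \is d.-homog -> L * B \is d.+1.-homog.
    by move=> hB; exact: (dhomogM hL hB).
  split; rewrite ?dhomogD ?dhomogZ ?hLA //.
  rewrite -[in LHS]Em mpolyXD hX -!mul_mpolyC mpolyCM.
  move: E; set W := ('X_[_] : {mpoly C[3]}) => E.
  transitivity ((a i)%:MP * L * W + (b i)%:MP * M * W + (c i)%:MP * T * W).
    by ring.
  by rewrite {1}E -mul_mpolyC [L ^+ d.+2]exprS; ring.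
rewrite (mpolyE A) big_seq; apply: (big_ind Q) => [|//|m mA].
  by exists 0, 0, 0; rewrite !dhomog0 scale0r !mulr0 !addr0.
by apply/QZ/QX/(dhomog_mf hA).
Qed.
End Evaluation.

(** * Intersection multiplicity at a smooth point *)

Section Fractions.
Variable R : idomainType.
Implicit Types a b c d : R.

Lemma tofrac_divD a b c d : b != 0 -> d != 0 ->
  tofrac a / tofrac b + tofrac c / tofrac d
    = tofrac (a * d + c * b) / tofrac (b * d).
Proof. by move=> nb nd; rewrite tofracD !tofracM addf_div ?tofrac_eq0. Qed.

Lemma tofrac_divM a b c d :
  tofrac a / tofrac b * (tofrac c / tofrac d) = tofrac (a * c) / tofrac (b * d).
Proof. by rewrite !tofracM mulf_div. Qed.

Lemma tofrac_div_eq a b c d : b != 0 -> d != 0 ->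
  tofrac a / tofrac b = tofrac c / tofrac d -> a * d = c * b.
Proof.
move=> nb nd /eqP; rewrite eqr_div ?tofrac_eq0 // -!tofracM tofrac_eq.
by move/eqP.
Qed.

Lemma tofrac_div1 a : tofrac a = tofrac a / tofrac 1.
Proof. by rewrite tofrac1 divr1. Qed.

End Fractions.

Fact local_step_identity (K : fieldType) (l le m t a d a0 b0 a1 a2 k : K) :
  l != 0 -> le != 0 -> d != 0 -> a0 != 0 ->
  l * (a - k * d) = m * a1 + t * a2 ->
  a / d = k + m / l * (a1 / d - a2 / d * (le / a0) * (b0 / le))
          + a2 / d * (le / a0) * ((t * a0 + m * b0) / (l * le)).
Proof.
move=> nl nle nd na0 E.
have -> : a = k * d + (m * a1 + t * a2) / l by rewrite -E; field.
by field; rewrite nl nle nd na0.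
Qed.

Section LocalRing.
Variables (C : fieldType) (P : 'rV[C]_3).
Implicit Types (A B D F G L : {mpoly C[3]}) (h : {fraction {mpoly C[3]}}).

Lemma tofrac_eval_neq0 D : eval_at P D != 0 -> tofrac D != 0.
Proof. by move=> /eval_at_neq0; rewrite tofrac_eq0. Qed.

Lemma local_ring_frac d A B : A \is d.-homog -> B \is d.-homog ->
  eval_at P B != 0 -> in_local_ring P (tofrac A / tofrac B).
Proof. by exists d, A, B. Qed.

Lemma local_ringC c : in_local_ring P (tofrac c%:MP).
Proof.
exists 0%N, c%:MP, 1; rewrite -(mulr1 c%:MP) mul_mpolyC dhomogZ ?dhomog1 //.
by rewrite rmorph1 oner_neq0 tofrac1 divr1.
Qed.

Lemma local_ringD h1 h2 :
  in_local_ring P h1 -> in_local_ring P h2 -> in_local_ring P (h1 + h2).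
Proof.
move=> [d [A [B [hA hB nB ->]]]] [e [A' [B' [hA' hB' nB' ->]]]].
rewrite tofrac_divD ?(eval_at_neq0 nB) ?(eval_at_neq0 nB') //.
apply: (@local_ring_frac (d + e)).
- by rewrite dhomogD ?(dhomogM hA hB') // addnC (dhomogM hA' hB).
- exact: dhomogM.
- by rewrite rmorphM mulf_neq0.
Qed.

Lemma local_ringM h1 h2 :
  in_local_ring P h1 -> in_local_ring P h2 -> in_local_ring P (h1 * h2).
Proof.
move=> [d [A [B [hA hB nB ->]]]] [e [A' [B' [hA' hB' nB' ->]]]].
rewrite tofrac_divM; apply: (@local_ring_frac (d + e)).
- exact: dhomogM.
- exact: dhomogM.
- by rewrite rmorphM mulf_neq0.
Qed.

Lemma local_ring0 : in_local_ring P 0.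
Proof. by rewrite -tofrac0 -mpolyC0; apply: local_ringC. Qed.

Lemma local_ring1 : in_local_ring P 1.
Proof. by rewrite -tofrac1 -mpolyC1; apply: local_ringC. Qed.

Lemma local_ringX h k : in_local_ring P h -> in_local_ring P (h ^+ k).
Proof.
move=> hP; elim: k => [|k IH]; first exact: local_ring1.
by rewrite exprS; apply: local_ringM.
Qed.

Lemma local_ringN h : in_local_ring P h -> in_local_ring P (- h).
Proof.
move=> hP; rewrite -mulN1r -tofrac1 -tofracN -mpolyC1 -mpolyCN.
by apply: local_ringM => //; apply: local_ringC.
Qed.

Lemma local_ring_sum (I : finType) (f : I -> {fraction {mpoly C[3]}}) :
  (forall i, in_local_ring P (f i)) -> in_local_ring P (\sum_i f i).
Proof.
move=> fP; apply: (big_ind (in_local_ring P)) => //; first exact: local_ring0.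
exact: local_ringD.
Qed.

End LocalRing.

(** Affine coordinates M/L, T/L centred at P, with an arc through P on which M/L
    is the parameter. The decomposition F = T A + M B with A(P) <> 0 says that
    the curve is smooth at P and not tangent to M = 0, so that M/L is a local
    parameter. How closely the arc follows the curve is left to the order of F
    along the germ. *)
Record chart (C : fieldType) (F : {mpoly C[3]}) (P : 'rV[C]_3) := Chart {
  chL : {mpoly C[3]}; chM : {mpoly C[3]}; chT : {mpoly C[3]};
  germ : 'I_3 -> {poly C};
  ch_homog : [/\ chL \is 1.-homog, chM \is 1.-homog & chT \is 1.-homog];
  ch_span : exists a b c : 'I_3 -> C,
    forall i, 'X_i = a i *: chL + b i *: chM + c i *: chT;
  ch_eval : [/\ eval_at P chL = 1, eval_at P chM = 0 & eval_at P chT = 0];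
  ch_germ0 : forall i, (germ i).[0] = P 0 i;
  ch_along : along germ chL = 1 /\ along germ chM = 'X;
  ch_neq0 : F != 0;
  ch_smooth : exists d A B, [/\ F \is d.+1.-homog, A \is d.-homog,
    B \is d.-homog, eval_at P A != 0 & F = chT * A + chM * B]
}.

Section Criterion.
Variables (C : fieldType) (F : {mpoly C[3]}) (P : 'rV[C]_3) (ch : chart F P).
Implicit Types (A B D G : {mpoly C[3]}) (h : {fraction {mpoly C[3]}}).
Implicit Types (q : {poly C}).

Local Notation L := (chL ch).
Local Notation M := (chM ch).
Local Notation T := (chT ch).
Local Notation g := (germ ch).

Lemma coprime_along k A : eval_at P A != 0 -> coprimep 'X^k (along g A).
Proof.
move=> nA; apply: coprimep_expl; rewrite coprimep_sym coprimepX.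
by rewrite /root (along_horner0 _ (ch_germ0 ch)).
Qed.

(** The expansion modulo X^k of h along the arc is q. It is stated on a
    representing fraction, and [jet_uniq] shows that the expansion depends on h
    alone. *)
Definition jet k h q := exists A D,
  [/\ eval_at P D != 0, h = tofrac A / tofrac D
    & 'X^k %| along g A - q * along g D].

Lemma jet_frac k A D : eval_at P D != 0 -> along g D = 1 ->
  jet k (tofrac A / tofrac D) (along g A).
Proof. by exists A, D; split=> //; rewrite H0 mulr1 subrr dvdp0. Qed.

Lemma jet_uniq k h q q' : jet k h q -> jet k h q' -> 'X^k %| q - q'.
Proof.
move=> [A [D [nD -> dA]]] [A' [D' [nD' EA dA']]].
move: (tofrac_div_eq (eval_at_neq0 nD) (eval_at_neq0 nD') EA).
move/(congr1 (along g)); rewrite !rmorphM /= => E.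
rewrite -(Gauss_dvdpl _ (coprime_along k nD)).
rewrite -(Gauss_dvdpl _ (coprime_along k nD')).
move: E dA dA'; set x := along g A; set y := along g D.
set x' := along g A'; set y' := along g D' => E dA dA'.
have -> : (q - q') * y * y' = (x' - q' * y') * y - (x - q * y) * y'.
  by transitivity (x' * y - x * y' + (q - q') * y * y'); [rewrite E|]; ring.
by apply: dvdp_sub; apply: dvdp_mulr.
Qed.

Lemma jetD k h1 h2 q1 q2 : jet k h1 q1 -> jet k h2 q2 -> jet k (h1 + h2) (q1 + q2).
Proof.
move=> [A [D [nD -> dA]]] [A' [D' [nD' -> dA']]].
rewrite tofrac_divD ?(eval_at_neq0 nD) ?(eval_at_neq0 nD') //.
exists (A * D' + A' * D), (D * D'); split=> //.
  by rewrite rmorphM mulf_neq0.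
rewrite rmorphD !rmorphM /=; move: dA dA'.
set x := along g A; set y := along g D.
set x' := along g A'; set y' := along g D' => dA dA'.
have -> : x * y' + x' * y - (q1 + q2) * (y * y') =
  (x - q1 * y) * y' + (x' - q2 * y') * y by ring.
by apply: dvdp_add; apply: dvdp_mulr.
Qed.

Lemma jetM k h1 h2 q1 q2 : jet k h1 q1 -> jet k h2 q2 -> jet k (h1 * h2) (q1 * q2).
Proof.
move=> [A [D [nD -> dA]]] [A' [D' [nD' -> dA']]].
rewrite tofrac_divM; exists (A * A'), (D * D'); split=> //.
  by rewrite rmorphM mulf_neq0.
rewrite !rmorphM /=; move: dA dA'.
set x := along g A; set y := along g D.
set x' := along g A'; set y' := along g D' => dA dA'.
have -> : x * x' - (q1 * q2) * (y * y') =
  (x - q1 * y) * x' + (x' - q2 * y') * (q1 * y) by ring.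
by apply: dvdp_add; apply: dvdp_mulr.
Qed.

Lemma jet_mul0 k h1 h2 : in_local_ring P h1 -> jet k h2 0 -> jet k (h1 * h2) 0.
Proof.
move=> [d [A [D [_ _ nD ->]]]] [A' [D' [nD' -> dA']]].
rewrite tofrac_divM; exists (A * A'), (D * D'); split=> //.
  by rewrite rmorphM mulf_neq0.
by move: dA'; rewrite !mul0r !subr0 rmorphM; apply: dvdp_mull.
Qed.

Lemma jetC k c : jet k (tofrac c%:MP) c%:P.
Proof.
have := @jet_frac k c%:MP 1; rewrite !rmorph1 divr1 alongC; apply=> //.
exact: oner_neq0.
Qed.

Lemma jet_dehomog k L' G : eval_at P L' != 0 -> 'X^k %| along g G ->
  jet k (dehomog L' G) 0.
Proof.
move=> nL dG; exists G, (L' ^+ (msize G).-1); rewrite rmorphXn expf_neq0 //.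
by rewrite mul0r subr0 tofracXn.
Qed.

Definition chm : {fraction {mpoly C[3]}} := tofrac M / tofrac L.
Local Notation m := chm.

Lemma evalL_neq0 : eval_at P L != 0.
Proof. by case: (ch_eval ch) => -> _ _; rewrite oner_neq0. Qed.
Hint Resolve evalL_neq0 : core.

Lemma jet_chm k : jet k m 'X.
Proof. by have [EL EM] := ch_along ch; rewrite -EM; apply: jet_frac. Qed.

Lemma local_ring_chm : in_local_ring P m.
Proof. by have [hL hM _] := ch_homog ch; apply: local_ring_frac hM hL _. Qed.

Definition in_chm q : {fraction {mpoly C[3]}} :=
  (map_poly (@tofrac _ \o @mpolyC 3 C) q).[m].

HB.instance Definition _ := GRing.RMorphism.copy in_chm
  (horner_eval m \o map_poly (@tofrac _ \o @mpolyC 3 C)).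

Lemma in_chmC c : in_chm c%:P = tofrac c%:MP.
Proof. by rewrite /in_chm map_polyC hornerC. Qed.
Lemma in_chmX : in_chm 'X = m.
Proof. by rewrite /in_chm map_polyX hornerX. Qed.

Lemma jet_in_chm k q : jet k (in_chm q) q.
Proof.
elim/poly_ind: q => [|q c IH]; first by rewrite -polyC0 in_chmC; apply: jetC.
rewrite rmorphD rmorphM /= in_chmC in_chmX.
by apply: jetD (jetC _ _); apply: jetM (jet_chm _).
Qed.

Lemma local_ring_in_chm q : in_local_ring P (in_chm q).
Proof.
elim/poly_ind: q => [|q c IH]; first by rewrite rmorph0; exact: local_ring0.
rewrite rmorphD rmorphM /= in_chmC in_chmX.
by apply: local_ringD (local_ringC _ _); apply: local_ringM local_ring_chm.
Qed.

(** A local ring element with nonzero value at P is invertible; the form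
    c + (M/L) h is the only one that occurs. *)
Lemma local_ring_unit c h : c != 0 -> in_local_ring P h ->
  exists2 u, in_local_ring P u & u * (tofrac c%:MP + m * h) = 1.
Proof.
move=> nc [d [A [D [hA hD nD ->]]]]; have [hL hM _] := ch_homog ch.
have [_ EM _] := ch_eval ch.
have hLD : L * D \is (1 + d).-homog by rewrite dhomogM.
have hMA : M * A \is (1 + d).-homog by rewrite dhomogM.
have nLD : eval_at P (L * D) != 0 by rewrite rmorphM mulf_neq0.
rewrite tofrac_divM [X in X + _]tofrac_div1.
rewrite tofrac_divD ?oner_neq0 ?(eval_at_neq0 nLD) // mul1r mulr1.
have nN : eval_at P (c%:MP * (L * D) + M * A) != 0.
  by rewrite rmorphD !rmorphM /= EM mul0r addr0 eval_atC !mulf_neq0.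
exists (tofrac (L * D) / tofrac (c%:MP * (L * D) + M * A)).
  apply: (@local_ring_frac _ _ (1 + d)) => //.
  by rewrite mul_mpolyC dhomogD ?dhomogZ.
rewrite tofrac_divM [X in tofrac X / _]mulrC divff // tofrac_eq0.
by rewrite mulf_neq0 ?(eval_at_neq0 nN) ?(eval_at_neq0 nLD).
Qed.

(** F and M/L generate the maximal ideal: since F = T A + M B with A(P) <> 0, the
    coordinate T/L lies in the ideal they span. *)
Lemma local_step h : in_local_ring P h -> exists c h1 h2,
  [/\ in_local_ring P h1, in_local_ring P h2
    & h = tofrac c%:MP + m * h1 + h2 * dehomog L F].
Proof.
move=> [d [A [D [hA hD nD ->]]]]; have [hL hM hT] := ch_homog ch.
have [a [b [c hX]]] := ch_span ch; have [EL EM ET] := ch_eval ch.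
have [e [A0 [B0 [hF hA0 hB0 nA0 EF]]]] := ch_smooth ch.
have nL : tofrac L != 0 by apply: (@tofrac_eval_neq0 _ P).
have nD' : tofrac D != 0 by apply: (@tofrac_eval_neq0 _ P).
have nA0' : tofrac A0 != 0 by apply: (@tofrac_eval_neq0 _ P).
pose k := eval_at P A / eval_at P D; pose W := L * (A - k *: D).
have hW : W \is d.+1.-homog.
  apply: (@dhomogM _ _ _ 1 L d) => //.
  by rewrite dhomogD // -scaleNr dhomogZ.
have [k' [A1 [A2 [hA1 hA2 EW]]]] := homog_decomp hL hM hT hX hW.
have k'0 : k' = 0.
  move/(congr1 (eval_at P)): EW; rewrite !rmorphD !rmorphM rmorphB /=.
  rewrite !eval_atZ rmorphXn /= EL EM ET expr1n !mul0r !addr0 mulr1 mul1r.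
  by rewrite divfK // subrr.
rewrite k'0 scale0r add0r in EW.
have -> : dehomog L F = (tofrac T * tofrac A0 + tofrac M * tofrac B0) / tofrac L ^+ e.+1.
  rewrite /dehomog -(dhomog_uniq (ch_neq0 ch) hF (dhomog_msize hF)) {1}EF.
  by rewrite tofracD !tofracM.
pose Le : {mpoly C[3]} := L ^+ e.
have nLe' : eval_at P Le != 0 by rewrite rmorphXn expf_neq0.
have nLe : tofrac Le != 0 by apply: (@tofrac_eval_neq0 _ P).
pose u := tofrac A2 / tofrac D * (tofrac Le / tofrac A0).
exists k, (tofrac A1 / tofrac D - u * (tofrac B0 / tofrac Le)), u.
have hu : in_local_ring P u.
  apply: local_ringM; first exact: local_ring_frac hA2 hD nD.
  by apply: local_ring_frac hA0 nA0; apply: homog1X.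
split=> //.
  apply: local_ringD; first exact: local_ring_frac hA1 hD nD.
  apply/local_ringN/local_ringM => //.
  apply: local_ring_frac hB0 _ _; first exact: homog1X.
  by rewrite rmorphXn expf_neq0.
have EL1 : tofrac L ^+ e.+1 = tofrac L * tofrac Le.
  by rewrite exprS /Le tofracXn.
have EW' : tofrac L * (tofrac A - tofrac k%:MP * tofrac D)
    = tofrac M * tofrac A1 + tofrac T * tofrac A2.
  by rewrite -tofracM -tofracB -!tofracM -tofracD mul_mpolyC; congr (tofrac _).
rewrite EL1; exact: local_step_identity nL nLe nD' nA0' EW'.
Qed.

(** Iterating [local_step] on the coefficient of M/L yields the Taylor expansion
    of h on the curve. *)
Lemma local_expansion k h : in_local_ring P h -> exists q u v,
  [/\ (size q <= k)%N, in_local_ring P u, in_local_ring P v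
    & h = in_chm q + u * dehomog L F + v * m ^+ k].
Proof.
elim: k h => [|k IH] h hP.
  exists 0, 0, h; rewrite size_poly0 rmorph0 mul0r mulr1 !add0r.
  by split=> //; exact: local_ring0.
have [c [h1 [h2 [h1P h2P ->]]]] := local_step hP.
have [q [u [v [sq uP vP ->]]]] := IH _ h1P.
exists (q * 'X + c%:P), (m * u + h2), v; split=> //.
- rewrite size_MXaddC; case: ifP => // _.
- by apply: local_ringD => //; apply: local_ringM => //; exact: local_ring_chm.
rewrite rmorphD rmorphM /= in_chmC in_chmX exprS.
by move: (in_chm q) (dehomog L F) (m ^+ k) => x y z; ring.
Qed.

Definition in_FG G h := exists a b,
  [/\ in_local_ring P a, in_local_ring P b & h = a * dehomog L F + b * dehomog L G].

(** If G has order j < k on the arc, then its expansion modulo F is the j-th power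
    of M/L times a unit, so this power lies in the ideal of F and G. *)
Lemma power_in_ideal k d G : G != 0 -> G \is d.-homog ->
  'X^k %| along g F -> ~~ ('X^k %| along g G) ->
  exists2 j, (j < k)%N & in_FG G (m ^+ j).
Proof.
move=> nG hG dF dG; have [EL EM] := ch_along ch.
have GP : in_local_ring P (dehomog L G).
  rewrite /dehomog -tofracXn; apply: local_ring_frac (dhomog_msize hG) _ _.
    by apply: homog1X; case: (ch_homog ch).
  by rewrite rmorphXn expf_neq0.
have [q [u [v [sq uP vP EG]]]] := local_expansion k GP.
have jG : jet k (dehomog L G) (along g G).
  rewrite /dehomog -tofracXn; apply: jet_frac.
    by rewrite rmorphXn expf_neq0.
  by rewrite rmorphXn /= EL expr1n.
have jE : jet k (dehomog L G) q.
  rewrite EG -[X in jet _ _ X]addr0 -[X in jet _ _ (X + _)]addr0.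
  apply: jetD; first apply: jetD.
  - exact: jet_in_chm.
  - by apply: jet_mul0 => //; apply: jet_dehomog.
  - apply: jet_mul0 => //; exists (M ^+ k), (L ^+ k); split.
    + by rewrite rmorphXn expf_neq0.
    + by rewrite /m expr_div_n !tofracXn.
    + by rewrite mul0r subr0 rmorphXn /= EM.
have nq : q != 0.
  apply: contraNneq dG => q0; have := jet_uniq jG jE.
  by rewrite q0 subr0.
have [j [q1 + Eq]] := multiplicity_XsubC q 0; rewrite nq /= subr0 in Eq * => nq1.
have nq10 : q1 != 0 by apply: contraNneq nq1 => ->; rewrite root0.
have ltjk : (j < k)%N.
  apply: leq_trans sq; rewrite Eq size_mulXn //.
  by rewrite -addn1 leq_add2l lt0n size_poly_eq0.
exists j => //.
have [q2 [c [Eq1 nc]]] : exists q2 c, q1 = q2 * 'X + c%:P /\ c != 0.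
  elim/poly_ind: q1 {Eq nq10} nq1 => [|q2 c _]; first by rewrite root0.
  by rewrite rootE hornerMXaddC mulr0 add0r => nc; exists q2, c.
pose w := tofrac c%:MP + m * (in_chm q2 + v * m ^+ (k - j).-1).
have [w' w'P Ew] : exists2 w', in_local_ring P w' & w' * w = 1.
  apply: local_ring_unit => //; apply: local_ringD (local_ring_in_chm _) _.
  by apply: local_ringM => //; apply: local_ringX; exact: local_ring_chm.
exists (- (w' * u)), w'; split=> //.
  by apply/local_ringN/local_ringM.
have Ek : m ^+ k = m * m ^+ (k - j).-1 * m ^+ j.
  by rewrite -exprS prednK ?subn_gt0 // -exprD subnK // ltnW.
have Eqm : in_chm q = (in_chm q2 * m + tofrac c%:MP) * m ^+ j.
  by rewrite Eq Eq1 rmorphM rmorphXn rmorphD rmorphM /= in_chmX in_chmC.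
have {EG}-> : dehomog L G = w * m ^+ j + u * dehomog L F.
  rewrite EG Ek Eqm /w.
  move: (in_chm q2) (dehomog L F) (m ^+ j) (m ^+ (k - j).-1) => x y z t; ring.
clearbody w; rewrite -[LHS]mul1r -Ew.
by move: (dehomog L F) (m ^+ j) => x y; ring.
Qed.

(** Modulo F and G only the powers of M/L below j survive, so more than j elements
    of the local ring are linearly dependent: the k x j matrix of their
    coefficients has a nontrivial left kernel. *)
Lemma in_FG_comb k (G : {mpoly C[3]}) j (h : 'I_k -> {fraction {mpoly C[3]}}) :
  in_FG G (m ^+ j) -> (j < k)%N -> (forall i, in_local_ring P (h i)) ->
  exists c : 'I_k -> C, (exists i, c i != 0) /\
    in_FG G (\sum_(i < k) tofrac (c i)%:MP * h i).
Proof.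
move=> [a [b [aP bP Em]]] ltjk hP.
have /fin_all_exists [r Hr] : forall i, exists r : {poly C} *
    ({fraction {mpoly C[3]}} * {fraction {mpoly C[3]}}),
    [/\ (size r.1 <= j)%N, in_local_ring P r.2.1, in_local_ring P r.2.2
    & h i = in_chm r.1 + r.2.1 * dehomog L F + r.2.2 * m ^+ j].
  by move=> i; have [q [u [v H]]] := local_expansion j (hP i); exists (q, (u, v)).
pose W := \matrix_(i < k, l < j) (r i).1`_l.
have [c nc cW] : exists2 c : 'rV[C]_k, c != 0 & c *m W = 0.
  have nK : kermx W != 0.
    rewrite kermx_eq0 /row_free neq_ltn; apply/orP; left.
    exact: leq_ltn_trans (rank_leq_col W) ltjk.
  exists (nz_row (kermx W)); first by rewrite nz_row_eq0.
  by apply/sub_kermxP; rewrite nz_row_sub.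
exists (c 0); split; first by apply/rV0Pn.
have q0 : \sum_i (c 0 i)%:P * (r i).1 = 0.
  apply/polyP => l; rewrite coef0 coef_sum.
  under eq_bigr do rewrite coefCM.
  have [ltlj|lejl] := ltnP l j; last first.
    rewrite big1 // => i _; rewrite nth_default ?mulr0 //.
    by have [sr _ _ _] := Hr i; apply: leq_trans sr lejl.
  have := congr1 (fun X : 'rV_j => X 0 (Ordinal ltlj)) cW; rewrite !mxE.
  by apply: etrans; apply: eq_bigr => i _; rewrite mxE.
exists (\sum_i tofrac (c 0 i)%:MP * ((r i).2.1 + (r i).2.2 * a)),
  (\sum_i tofrac (c 0 i)%:MP * ((r i).2.2 * b)); split.
- apply: local_ring_sum => i; have [_ uP vP _] := Hr i.
  apply: local_ringM; first exact: local_ringC.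
  by apply: local_ringD => //; apply: local_ringM.
- apply: local_ring_sum => i; have [_ uP vP _] := Hr i.
  apply: local_ringM; first exact: local_ringC.
  by apply: local_ringM.
have Q0 : \sum_i tofrac (c 0 i)%:MP * in_chm (r i).1 = 0.
  rewrite -[RHS](rmorph0 in_chm) -q0 rmorph_sum; apply: eq_bigr => i _.
  by rewrite rmorphM /= in_chmC.
rewrite !mulr_suml -big_split /= -[LHS]subr0 -[X in _ - X = _]Q0 -sumrB.
apply: eq_bigr => i _.
have [_ _ _ ->] := Hr i; rewrite Em.
move: (in_chm _) (dehomog L F) (dehomog L G) (tofrac _) => x y z t; ring.
Qed.

(** If the order of G on the arc is at least k, the powers of M/L below k are
    independent modulo (F, G), because their expansions are; otherwise
    [in_FG_comb] gives a dependency among any k elements. *)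
Theorem intersection_mult_geP k d G : G != 0 -> G \is d.-homog ->
  'X^k %| along g F ->
  intersection_mult_ge k F G P <-> 'X^k %| along g G.
Proof.
move=> nG hG dF; split=> [[h [hP indep]]|dG].
  apply: contraT => dG; have [j ltjk jFG] := power_in_ideal nG hG dF dG.
  have [c [[i /eqP ci] [a [b [aP bP E]]]]] := in_FG_comb jFG ltjk hP.
  case: ci; apply: indep; exists L, a, b; split=> //.
  by case: (ch_homog ch).
(* the powers of the local parameter are independent *)
exists (fun i => m ^+ i); split=> [i|c].
  by apply: local_ringX; exact: local_ring_chm.
move=> [L' [a [b [hL' nL' aP bP E]]]] i.
pose q := \poly_(l < k) (if insub l is Some l then c l else 0).
have cq (l : 'I_k) : q`_l = c l by rewrite coef_poly ltn_ord valK.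
suff q0 : q = 0 by rewrite -cq q0 coef0.
have Eq : \sum_(i < k) tofrac (c i)%:MP * m ^+ i = in_chm q.
  rewrite /in_chm (@horner_coef_wide _ k) ?size_map_poly ?size_poly //.
  by apply: eq_bigr => l _; rewrite coef_map cq.
have jq : jet k (in_chm q) 0.
  rewrite -Eq E -[X in jet _ _ X]addr0.
  by apply: jetD; apply: jet_mul0 => //; apply: jet_dehomog.
apply/eqP; apply: contraT => nq.
have := jet_uniq (jet_in_chm k q) jq; rewrite subr0 => /(dvdp_leq nq).
by rewrite size_polyXn ltnNge size_poly.
Qed.

End Criterion.

(** * Existence of charts *)

Section Chart.
Variable C : fieldType.
Implicit Types (F : {mpoly C[3]}) (P : 'rV[C]_3).

Lemma euler_identity d F : F \is d.-homog ->
  \sum_(i < 3) 'X_i * F^`M(i) = d%:R *: F.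
Proof.
move=> hF; have EX m : mdeg m = d ->
    \sum_(i < 3) 'X_i * ('X_[m] : {mpoly C[3]})^`M(i) = d%:R *: 'X_[m].
  move=> <-; rewrite mdegE natr_sum scaler_suml; apply: eq_bigr => i _.
  rewrite mderivX -scalerAr -mpolyXD; have [->|mi] := eqVneq (m i) 0%N.
    by rewrite !scale0r.
  by rewrite addmC submK // lep1mP.
rewrite [in LHS](mpolyE F) [in RHS](mpolyE F) scaler_sumr.
under eq_bigr do rewrite linear_sum mulr_sumr.
rewrite exchange_big /=; apply: eq_big_seq => m mF.
under eq_bigr do rewrite mderivZ -scalerAr.
by rewrite -scaler_sumr EX ?(dhomog_mf hF mF) // !scalerA mulrC.
Qed.

(** A basis of row vectors starting with p, with dual basis the columns of Bi, such
    that g is a multiple of the last dual vector. The middle vector is the cross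
    product of g and u, where u is not orthogonal to p. *)
Lemma frame_exists (p g : 'rV[C]_3) : p != 0 -> g != 0 ->
  \sum_i p 0 i * g 0 i = 0 ->
  exists B Bi : 'M[C]_3, exists2 c : C, c != 0 &
    [/\ B *m Bi = 1%:M, forall i, B 0 i = p 0 i
      & forall i, g 0 i = c * Bi i (inord 2)].
Proof.
move=> /rV0Pn [ip np] /rV0Pn [ig ng].
pose u : 'rV[C]_3 := \row_i (i == ip)%:R; pose e : 'rV[C]_3 := \row_i (i == ig)%:R.
have Epu : \sum_i p 0 i * u 0 i = p 0 ip.
  rewrite (bigD1 ip) //= mxE eqxx mulr1 big1 ?addr0 // => i /negbTE ni.
  by rewrite mxE ni mulr0.
have Ege : \sum_i g 0 i * e 0 i = g 0 ig.
  rewrite (bigD1 ig) //= mxE eqxx mulr1 big1 ?addr0 // => i /negbTE ni.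
  by rewrite mxE ni mulr0.
move: (p 0 ip) (g 0 ig) np ng Epu Ege => pu ge npu nge.
rewrite !big_ord_recl !big_ord0 !addr0; clearbody u e.
set i0 := ord0 : 'I_3; set i1 := lift ord0 ord0 : 'I_3.
set i2 := lift ord0 (lift ord0 ord0) : 'I_3.
set p0 := p 0 i0; set p1 := p 0 i1; set p2 := p 0 i2.
set g0 := g 0 i0; set g1 := g 0 i1; set g2 := g 0 i2.
move: (u 0 i0) (u 0 i1) (u 0 i2) (e 0 i0) (e 0 i1) (e 0 i2).
move=> u0 u1 u2 e0 e1 e2 Epu Ege Epg.
pose ue := u0 * e0 + (u1 * e1 + u2 * e2).
pose a := pu^-1; pose b := ue / (pu * ge); pose k := (pu * ge)^-1.
pose B := \matrix_(i < 3, j < 3) (nth [::] [:: [:: p0; p1; p2];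
  [:: g1 * u2 - g2 * u1; g2 * u0 - g0 * u2; g0 * u1 - g1 * u0];
  [:: e0; e1; e2]] i)`_j.
pose Bi := \matrix_(j < 3, i < 3) (nth [::] [:: 
  [:: a * u0 - b * g0; a * u1 - b * g1; a * u2 - b * g2];
  [:: k * (p2 * e1 - p1 * e2); k * (p0 * e2 - p2 * e0); k * (p1 * e0 - p0 * e1)];
  [:: g0 / ge; g1 / ge; g2 / ge]] i)`_j.
exists B, Bi, ge => //; split.
- apply/matrixP => i j; rewrite !mxE !big_ord_recl big_ord0 !mxE.
  have E1 : a * pu - b * 0 = 1 by rewrite /a; field.
  have E2 : a * ue - b * ge = 0 by rewrite /a /b; field; rewrite npu nge.
  have E3 : k * (pu * ge - 0 * ue) = 1 by rewrite /k; field; rewrite npu nge.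
  have E4 : ge / ge = 1 by rewrite divff.
  have E5 : 0 / ge = 0 by rewrite mul0r.
  rewrite -{1}Epu -Epg in E1; rewrite -{1}Ege /ue in E2.
  rewrite -{1}Epu -{1}Ege -Epg /ue in E3; rewrite -{1}Ege in E4.
  rewrite -{1}Epg in E5.
  case: i => [[|[|[|//]]] ?]; case: j => [[|[|[|//]]] ?] /=.
  + by rewrite -E1; ring.
  + by ring.
  + by rewrite -[RHS]E5; ring.
  + by ring.
  + by rewrite -E3; ring.
  + by ring.
  + by rewrite -[RHS]E2; ring.
  + by ring.
  + by rewrite -E4; ring.
- by move=> i; rewrite mxE; case: i => [[|[|[|//]]] ?] /=; congr (p 0 _); apply: val_inj.
- move=> i; rewrite mxE inordK //=.
  by case: i => [[|[|[|//]]] ?] /=; rewrite mulrC divfK //; congr (g 0 _); apply: val_inj.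
Qed.

Lemma mderivU i j : ('X_j : {mpoly C[3]})^`M(i) = (i == j)%:R.
Proof.
rewrite mderivX mnm1E eq_sym; case: eqVneq => [->|]; last by rewrite scale0r.
by rewrite scale1r -{1}(add0m U_(j)%MM) addmK mpolyX0.
Qed.

Lemma homog1_sum (v : 'I_3 -> C) :
  (\sum_i v i *: 'X_i : {mpoly C[3]}) \is 1.-homog.
Proof. by apply: rpred_sum => i _; apply: dhomogZ; apply: homogX1. Qed.

Lemma Xk_dvd (p : {poly C}) : p.[0] = 0 -> 'X %| p.
Proof. by move=> p0; rewrite -['X]subr0 dvdp_XsubCl /root p0. Qed.

(** Up to order k + 3, a correction of Y at order k + 2 changes T A by A(P) times the
    correction and leaves M B unchanged, since M restricts to X. *)
Lemma newton_step F A B T M P (D E : 'I_3 -> C) k Y :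
  let g (Y : {poly C}) i := (P 0 i)%:P + (D i)%:P * 'X + (E i)%:P * Y in
  F = T * A + M * B -> (forall Y, along (g Y) M = 'X) ->
  (forall Y, along (g Y) T = Y) -> eval_at P A != 0 ->
  'X^(k.+2) %| along (g Y) F -> 'X^2 %| Y ->
  exists2 Y', 'X^2 %| Y' & 'X^(k.+3) %| along (g Y') F.
Proof.
move=> g EF gM gT nA /dvdpP [r Er] dY.
pose c := r.[0] / eval_at P A; pose Y' := Y - c *: 'X^(k.+2).
have dX2 : 'X^2 %| c *: ('X^(k.+2) : {poly C}).
  by rewrite -mul_polyC dvdp_mull // dvdp_exp2l.
have dY' : 'X^2 %| Y' by rewrite dvdp_sub.
exists Y' => //.
have gg i : 'X^(k.+2) %| g Y' i - g Y i.
  have -> : g Y' i - g Y i = - (E i)%:P * c%:P * 'X^(k.+2).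
    by rewrite /g /Y' -mul_polyC; ring.
  exact: dvdp_mull.
have /dvdpP [a Ea] := along_congr A gg.
have /dvdpP [b Eb] := along_congr B gg.
have -> : along (g Y') F = Y' * (a * 'X^(k.+2)) + 'X * (b * 'X^(k.+2))
    + ('X^(k.+2) * r - c *: 'X^(k.+2) * along (g Y) A).
  move: Er; rewrite EF !rmorphD !rmorphM /= !gM !gT -Ea -Eb => Er.
  rewrite [_ * r]mulrC -Er /Y'; ring.
have dr : 'X %| r - c *: along (g Y) A.
  apply: Xk_dvd; rewrite hornerD hornerN hornerZ (@along_horner0 _ _ P).
    by rewrite divfK // subrr.
  have /dvdpP [y ->] := dY.
  by move=> i; rewrite !hornerE /= !(mul0r, mulr0, addr0, expr0n).
have dY1 : 'X %| Y' by apply: dvdp_trans dY'; rewrite -{1}['X]expr1 dvdp_exp2l.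
apply: dvdp_add; first apply: dvdp_add.
- by rewrite exprS; apply: dvdp_mul => //; apply: dvdp_mull.
- by rewrite exprS; apply: dvdp_mul => //; apply: dvdp_mull.
have -> : 'X^(k.+2) * r - c *: 'X^(k.+2) * along (g Y) A
  = 'X^(k.+2) * (r - c *: along (g Y) A) by rewrite -!mul_polyC; ring.
by rewrite exprSr; apply: dvdp_mul.
Qed.

(** The arc is P + X D + Y(X) E, where D spans the tangent with P, and E is a
    transversal vector. By Euler's identity the gradient is orthogonal to P, so
    the tangent passes through P and [frame_exists] applies. Writing
    F = M B + T A, the gradient shows that B(P) = 0, which starts Newton's method
    at order 2 with Y = 0, and that A(P) <> 0. *)
Lemma chart_exists d F P n : F \is d.+1.-homog -> F != 0 -> P != 0 ->
  on_curve F P -> ~ singular_point F P ->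
  exists ch : chart F P, [/\ 'X^n %| along (germ ch) F,
    'X^2 %| along (germ ch) (chT ch)
    & exists2 c, c != 0 & tangent_line F P = c *: chT ch].
Proof.
move=> hF nF nP FP nsing.
pose gr : 'rV[C]_3 := \row_i eval_at P F^`M(i).
have ngr : gr != 0.
  apply: contra_notN nsing => /eqP /rowP gr0; split=> // i.
  by have := gr0 i; rewrite !mxE.
have Pgr : \sum_i P 0 i * gr 0 i = 0.
  have := congr1 (eval_at P) (euler_identity hF).
  rewrite eval_atZ FP mulr0 rmorph_sum; apply: etrans; apply: eq_bigr => i _.
  by rewrite rmorphM /= eval_atX mxE.
have [Bm [Bi [c nc [BBi B0 gE]]]] := frame_exists nP ngr Pgr.
pose i1 : 'I_3 := inord 1; pose i2 : 'I_3 := inord 2.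
have n01 : (0 == i1 :> 'I_3) = false by rewrite -val_eqE /= inordK.
have n02 : (0 == i2 :> 'I_3) = false by rewrite -val_eqE /= inordK.
have n12 : (i1 == i2 :> 'I_3) = false by rewrite -val_eqE /= !inordK.
have n10 := n01; have n20 := n02; have n21 := n12.
rewrite eq_sym in n10; rewrite eq_sym in n20; rewrite eq_sym in n21.
have BBij i j : \sum_k Bm i k * Bi k j = (i == j)%:R.
  by have /matrixP/(_ i j) := BBi; rewrite !mxE.
have sum3 (V : nmodType) (f : 'I_3 -> V) : \sum_i f i = f 0 + f i1 + f i2.
  have -> : i1 = lift ord0 ord0 by apply: val_inj; rewrite /= inordK.
  have -> : i2 = lift ord0 (lift ord0 ord0) by apply: val_inj; rewrite /= inordK.
  by rewrite !big_ord_recl big_ord0 addr0 addrA.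
have BiB i j : Bi i 0 * Bm 0 j + Bi i i1 * Bm i1 j + Bi i i2 * Bm i2 j = (i == j)%:R.
  by have /matrixP/(_ i j) := mulmx1C BBi; rewrite !mxE sum3.
pose form k : {mpoly C[3]} := \sum_i Bi i k *: 'X_i.
have hform k : form k \is 1.-homog by apply: homog1_sum.
pose g (Y : {poly C}) i := (P 0 i)%:P + (Bm i1 i)%:P * 'X + (Bm i2 i)%:P * Y.
have gform Y k : along (g Y) (form k) =
    (0 == k)%:R + (i1 == k)%:R * 'X + (i2 == k)%:R * Y.
  rewrite -!(rmorph_nat polyC) /= -!BBij rmorph_sum /= !rmorph_sum /=.
  rewrite !mulr_suml -!big_split /=; apply: eq_bigr => i _.
  rewrite alongZ alongX -mul_polyC /g -B0 !rmorphM /=; ring.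
have Pform k : eval_at P (form k) = (0 == k)%:R.
  rewrite -BBij rmorph_sum; apply: eq_bigr => i _.
  by rewrite /= eval_atZ eval_atX B0 mulrC.
have hX i : 'X_i = Bm 0 i *: form 0 + Bm i1 i *: form i1 + Bm i2 i *: form i2.
  rewrite !scaler_sumr -!big_split /= (bigD1 i) //= big1 ?addr0.
    rewrite !scalerA -!scalerDl ![Bm _ i * _]mulrC BiB eqxx scale1r //.
  move=> j nj; rewrite !scalerA -!scalerDl ![Bm _ i * _]mulrC BiB.
  by rewrite (negbTE nj) scale0r.
have [e [B [A [hB hA EF]]]] := homog_decomp (hform 0) (hform i1) (hform i2) hX hF.
have e0 : e = 0.
  have := congr1 (eval_at P) EF; rewrite !rmorphD !rmorphM /= eval_atZ rmorphXn /=.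
  by rewrite !Pform FP n01 n02 !mul0r !addr0 eqxx expr1n mulr1.
rewrite e0 scale0r add0r addrC in EF.
have dform i k : (form k)^`M(i) = (Bi i k)%:MP.
  rewrite linear_sum /= (bigD1 i) //= mderivZ mderivU eqxx big1 ?addr0.
    by rewrite -mul_mpolyC mulr1.
  by move=> j nj; rewrite mderivZ mderivU eq_sym (negbTE nj) scaler0.
have dF i : gr 0 i = Bi i i1 * eval_at P B + Bi i i2 * eval_at P A.
  rewrite mxE EF mderivD !mderivM !rmorphD !rmorphM /= !Pform n01 n02.
  by rewrite !dform !eval_atC !mul0r !addr0 addrC.
have dFr k : \sum_i Bm k i * gr 0 i =
    (k == i1)%:R * eval_at P B + (k == i2)%:R * eval_at P A.
  rewrite -!BBij !mulr_suml -big_split; apply: eq_bigr => i _ /=.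
  by rewrite dF; ring.
have dFr' k : \sum_i Bm k i * gr 0 i = c * (k == i2)%:R.
  by rewrite -BBij mulr_sumr; apply: eq_bigr => i _; rewrite gE; ring.
have B0P : eval_at P B = 0.
  by have := dFr i1; rewrite dFr' eqxx n12 mulr0 mul1r mul0r addr0.
have AP : eval_at P A = c.
  by have := dFr i2; rewrite dFr' eqxx n21 mulr1 mul0r add0r mul1r.
have gM Y : along (g Y) (form i1) = 'X.
  by rewrite gform n01 eqxx n21 mul0r add0r mul1r addr0.
have gT Y : along (g Y) (form i2) = Y.
  by rewrite gform n02 eqxx n12 !mul0r !add0r mul1r.
have nA : eval_at P A != 0 by rewrite AP.
have [Y dY dFY] : exists2 Y, 'X^2 %| Y & 'X^(n.+2) %| along (g Y) F.
  elim: n => [|n [Y dY dFY]]; last exact: (newton_step EF gM gT nA dFY dY).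
  exists 0; rewrite ?dvdp0 // EF rmorphD !rmorphM /= gM gT mul0r add0r expr2.
  apply: dvdp_mul => //; apply: Xk_dvd; rewrite (@along_horner0 _ _ P) // => i.
  by rewrite /g !hornerE.
have g0 i : (g Y i).[0] = P 0 i.
  by have /dvdpP [y ->] := dY; rewrite !hornerE /= !(mul0r, mulr0, addr0, expr0n).
have gL : along (g Y) (form 0) = 1.
  by rewrite gform n10 n20 eqxx !mul0r !addr0.
have Hh : [/\ form 0 \is 1.-homog, form i1 \is 1.-homog & form i2 \is 1.-homog].
  by split.
have Hs : exists a b c : 'I_3 -> C,
    forall i, 'X_i = a i *: form 0 + b i *: form i1 + c i *: form i2.
  by exists (Bm 0), (Bm i1), (Bm i2).
have He : [/\ eval_at P (form 0) = 1, eval_at P (form i1) = 0 & eval_at P (form i2) = 0].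
  by rewrite !Pform eqxx n01 n02.
have Hd : exists d A B, [/\ F \is d.+1.-homog, A \is d.-homog,
    B \is d.-homog, eval_at P A != 0 & F = form i2 * A + form i1 * B].
  by exists d, A, B.
exists (Chart Hh Hs He g0 (conj gL (gM Y)) nF Hd); split=> /=.
- by apply: dvdp_trans dFY; rewrite dvdp_exp2l // -addn2 leq_addr.
- by rewrite gT.
exists c => //; rewrite /tangent_line /form scaler_sumr; apply: eq_bigr => i _.
by rewrite scalerA -gE mxE.
Qed.

Lemma tangent_line_homog F P : tangent_line F P \is 1.-homog.
Proof. exact: homog1_sum. Qed.

Lemma tangent_line_neq0 F P :
  on_curve F P -> ~ singular_point F P -> tangent_line F P != 0.
Proof.
move=> FP; apply: contra_notN => /eqP T0; split=> // i.
apply/eqP; rewrite -(mpolyC_eq0 3); apply/eqP; rewrite -(mderiv0 C i) -T0.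
rewrite linear_sum /= (bigD1 i) //= mderivZ mderivU eqxx big1 ?addr0.
  by rewrite -mul_mpolyC mulr1.
by move=> j nj; rewrite mderivZ mderivU eq_sym (negbTE nj) scaler0.
Qed.

End Chart.

(** * Expansion of forms in a chart *)

Section Expansions.
Variable C : fieldType.
Implicit Types (A L M T : {mpoly C[3]}).

Lemma homog0E A : A \is 0.-homog -> exists c, A = c%:MP.
Proof.
move=> hA; exists A@_0; apply/mpolyP => m; rewrite mcoeffC eq_sym.
have [->|nm] := eqVneq m 0%MM; first by rewrite mulr1.
by rewrite mulr0 (dhomog_nemf_coeff hA) // mdeg_eq0.
Qed.

Variables (L M T : {mpoly C[3]}).
Hypotheses (hL : L \is 1.-homog) (hM : M \is 1.-homog) (hT : T \is 1.-homog).
Hypothesis hX : exists a b c : 'I_3 -> C,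
  forall i, 'X_i = a i *: L + b i *: M + c i *: T.

Lemma homog1E A : A \is 1.-homog ->
  exists a b c : C, A = a *: L + b *: M + c *: T.
Proof.
move=> hA; have [a [b [c H]]] := hX.
have [e [A1 [A2 [/homog0E [k ->] /homog0E [l ->] ->]]]] := homog_decomp hL hM hT H hA.
by exists e, k, l; rewrite -!mul_mpolyC; ring.
Qed.

Lemma homog2E A : A \is 2.-homog -> exists a b c d e f : C,
  A = a%:MP * L ^+ 2 + b%:MP * (L * M) + c%:MP * M ^+ 2
      + d%:MP * (L * T) + e%:MP * (M * T) + f%:MP * T ^+ 2.
Proof.
move=> hA; have [a [b [c H]]] := hX.
have [e [A1 [A2 [hA1 hA2 ->]]]] := homog_decomp hL hM hT H hA.
have [a1 [b1 [c1 ->]]] := homog1E hA1; have [a2 [b2 [c2 ->]]] := homog1E hA2.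
exists e, a1, b1, a2, (c1 + b2), c2; rewrite -!mul_mpolyC rmorphD /=; ring.
Qed.

Lemma homog3E A : A \is 3.-homog -> exists a b c d e f g h i j : C,
  A = a%:MP * L ^+ 3 + b%:MP * (L ^+ 2 * M) + c%:MP * (L * M ^+ 2)
      + d%:MP * M ^+ 3 + e%:MP * (L ^+ 2 * T) + f%:MP * (L * M * T)
      + g%:MP * (M ^+ 2 * T) + h%:MP * (L * T ^+ 2) + i%:MP * (M * T ^+ 2)
      + j%:MP * T ^+ 3.
Proof.
move=> hA; have [a [b [c H]]] := hX.
have [e [A1 [A2 [hA1 hA2 ->]]]] := homog_decomp hL hM hT H hA.
have [a1 [b1 [c1 [d1 [e1 [f1 ->]]]]]] := homog2E hA1.
have [a2 [b2 [c2 [d2 [e2 [f2 ->]]]]]] := homog2E hA2.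
exists e, a1, b1, c1, a2, (d1 + b2), (e1 + c2), d2, (f1 + e2), f2.
by rewrite -!mul_mpolyC !rmorphD /=; ring.
Qed.

Lemma along_homog2E g a b c d e f :
  along g (a%:MP * L ^+ 2 + b%:MP * (L * M) + c%:MP * M ^+ 2
      + d%:MP * (L * T) + e%:MP * (M * T) + f%:MP * T ^+ 2)
  = a%:P * along g L ^+ 2 + b%:P * (along g L * along g M)
    + c%:P * along g M ^+ 2 + d%:P * (along g L * along g T)
    + e%:P * (along g M * along g T) + f%:P * along g T ^+ 2.
Proof. by rewrite !alongE. Qed.

Lemma along_homog3E g k0 k1 k2 k3 k4 k5 k6 k7 k8 k9 :
  along g (k0%:MP * L ^+ 3 + k1%:MP * (L ^+ 2 * M) + k2%:MP * (L * M ^+ 2)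
      + k3%:MP * M ^+ 3 + k4%:MP * (L ^+ 2 * T) + k5%:MP * (L * M * T)
      + k6%:MP * (M ^+ 2 * T) + k7%:MP * (L * T ^+ 2) + k8%:MP * (M * T ^+ 2)
      + k9%:MP * T ^+ 3)
  = let l := along g L in let m := along g M in let t := along g T in
    k0%:P * l ^+ 3 + k1%:P * (l ^+ 2 * m) + k2%:P * (l * m ^+ 2)
      + k3%:P * m ^+ 3 + k4%:P * (l ^+ 2 * t) + k5%:P * (l * m * t)
      + k6%:P * (m ^+ 2 * t) + k7%:P * (l * t ^+ 2) + k8%:P * (m * t ^+ 2)
      + k9%:P * t ^+ 3.
Proof. by rewrite !alongE. Qed.

(** Comparison of the two lowest coefficients, to be iterated along series in
    which every term has a larger order than the one before it. *)
Lemma dvd_peel n (a b : C) (r : {poly C}) :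
  'X^(n.+2) %| a%:P + b%:P * 'X + 'X^2 * r -> [/\ a = 0, b = 0 & 'X^n %| r].
Proof.
move=> /dvdpP [q E].
have E0 : a = 0.
  have := congr1 (fun p : {poly C} => p`_0) E.
  by rewrite !coefD coefC /= coefMX coefXnM coefMXn /= !addr0.
have E1 : b = 0.
  have := congr1 (fun p : {poly C} => p`_1) E.
  by rewrite !coefD coefC /= coefMX coefC coefXnM coefMXn /= addr0 add0r.
split=> //; apply/dvdpP; exists q.
have nX : ('X^2 : {poly C}) != 0 by rewrite -size_poly_eq0 size_polyXn.
apply: (mulfI nX); move: E; rewrite E0 E1 mul0r !add0r => ->.
by rewrite -addn2 exprD; ring.
Qed.

Lemma dvd_cancel n (y r : {poly C}) : y.[0] != 0 ->
  'X^n %| y * r -> 'X^n %| r.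
Proof.
move=> ny; rewrite Gauss_dvdpr //; apply: coprimep_expl.
by rewrite coprimep_sym coprimepX.
Qed.

End Expansions.

(** * The Hesse cubic in permuted coordinates *)

(** The factor 3 S - t Z is the tangent at the flex (1 : -1 : 0), and the identity
    shows its contact of order 3 there. The remaining flexes are obtained by
    permuting the coordinates and scaling by cube roots of unity. *)
Fact hesse_flex_identity (R : comPzRingType) (X Y Z t : R) :
  let S := X + Y in let D := X - Y in
  108 * (X ^+ 3 + Y ^+ 3 + Z ^+ 3 + t * (X * Y * Z))
  = (3 * S - t * Z) * (27 * D ^+ 2 + (3 * S + 2 * t * Z) ^+ 2)
    + 4 * (t ^+ 3 + 27) * Z ^+ 3.
Proof. by move=> S D; rewrite /S /D; ring. Qed.

Section Cubic.
Variables (C : numFieldType) (t : C).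
Local Notation F := (cubic_F t).
Implicit Types (P Q : 'rV[C]_3) (a b c : 'I_3).

Lemma ord3P a : [\/ a = inord 0, a = inord 1 | a = inord 2].
Proof.
by case: a => [[|[|[|//]]] Ha];
  [apply: Or31 | apply: Or32 | apply: Or33]; apply: val_inj; rewrite /= inordK.
Qed.

Lemma inord3_eq : ((inord 0 == inord 1 :> 'I_3) = false) *
  ((inord 0 == inord 2 :> 'I_3) = false) * ((inord 1 == inord 2 :> 'I_3) = false) *
  ((inord 1 == inord 0 :> 'I_3) = false) * ((inord 2 == inord 0 :> 'I_3) = false) *
  ((inord 2 == inord 1 :> 'I_3) = false).
Proof. by do !split; rewrite -val_eqE /= !inordK. Qed.

Lemma uniq012 : uniq [:: inord 0; inord 1; inord 2 : 'I_3].
Proof. by rewrite /= !inE !inord3_eq. Qed.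

(** Reduces a statement on three distinct coordinates to the six permutations; the
    equation of the cubic is symmetric, so most lemmas are proved for all of
    them at once. *)
Lemma uniq3P (Q : 'I_3 -> 'I_3 -> 'I_3 -> Prop) :
  let i := inord 0 in let j := inord 1 in let k := inord 2 in
  Q i j k -> Q j k i -> Q k i j -> Q i k j -> Q k j i -> Q j i k ->
  forall a b c, uniq [:: a; b; c] -> Q a b c.
Proof.
move=> /= q1 q2 q3 q4 q5 q6 a b c; rewrite /= !inE.
by case: (ord3P a) => ->; case: (ord3P b) => ->; case: (ord3P c) => ->;
  rewrite ?inord3_eq ?eqxx ?orbT.
Qed.

Lemma uniq3_cases (a b c : 'I_3) : uniq [:: a; b; c] ->
  forall i, [\/ i = a, i = b | i = c].
Proof.
move=> u i; elim/uniq3P: u; case: (ord3P i) => ->;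
  by [apply: Or31 | apply: Or32 | apply: Or33].
Qed.

Lemma uniq_rot1 a b c : uniq [:: a; b; c] -> uniq [:: b; c; a].
Proof. by move=> u; rewrite -(rot_uniq 2). Qed.

Lemma sum3 (V : nmodType) (f : 'I_3 -> V) a b c : uniq [:: a; b; c] ->
  \sum_i f i = f a + f b + f c.
Proof.
move=> u; have -> : \sum_i f i = f (inord 0) + f (inord 1) + f (inord 2).
  have -> : inord 0 = ord0 :> 'I_3 by apply: val_inj; rewrite /= inordK.
  have -> : inord 1 = lift ord0 ord0 :> 'I_3 by apply: val_inj; rewrite /= inordK.
  have -> : inord 2 = lift ord0 (lift ord0 ord0) :> 'I_3.
    by apply: val_inj; rewrite /= inordK.
  by rewrite !big_ord_recl big_ord0 addr0 addrA.
move: (f) => {}f.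
elim/uniq3P: u => //.
- by rewrite -addrA addrC.
- by rewrite addrC addrA.
- by rewrite addrAC.
- by rewrite addrC [X in _ + X]addrC addrA.
- by rewrite [X in X + _]addrC.
Qed.

Lemma cubic_FE a b c : uniq [:: a; b; c] ->
  F = 'X_a ^+ 3 + 'X_b ^+ 3 + 'X_c ^+ 3 + t%:MP * ('X_a * 'X_b * 'X_c).
Proof. by move=> u; rewrite /cubic_F -mul_mpolyC; elim/uniq3P: u; ring. Qed.

Lemma cubic_homog : F \is 3.-homog.
Proof.
have hX := @homogX1 C.
rewrite /cubic_F; apply: dhomogD.
  by apply: dhomogD; [apply: dhomogD|]; apply: homog1X.
by apply: dhomogZ; apply: (@dhomogM _ _ _ 2); first apply: (@dhomogM _ _ _ 1).
Qed.

Section Coordinates.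
Variables (a b c : 'I_3) (u : uniq [:: a; b; c]).
Variable P : 'rV[C]_3.

Lemma eval_cubic : eval_at P F = P 0 a ^+ 3 + P 0 b ^+ 3 + P 0 c ^+ 3
  + t * (P 0 a * P 0 b * P 0 c).
Proof.
by rewrite (cubic_FE u) !eval_atE.
Qed.

Lemma deriv_cubic : F^`M(a) = 3%:MP * 'X_a ^+ 2 + t%:MP * ('X_b * 'X_c).
Proof.
have [/negbTE nab /negbTE nac] : a != b /\ a != c.
  by apply/andP; move: u; rewrite /= !inE negb_or; case/and3P.
rewrite (cubic_FE u) !mderivD mderiv_mulC !expr2 !exprS !expr0 !mderivM !mderivU.
rewrite eqxx nab nac -mpolyC1 mderivC !mulr0n !mulr1n [3%:MP]mpolyC_nat.
ring.
Qed.

Lemma eval_deriv_cubic :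
  eval_at P F^`M(a) = 3 * P 0 a ^+ 2 + t * (P 0 b * P 0 c).
Proof.
by rewrite deriv_cubic !eval_atE.
Qed.

Lemma deriv2_cubic : F^`M(a)^`M(a) = 6%:MP * 'X_a.
Proof.
have [/negbTE nab /negbTE nac] : a != b /\ a != c.
  by apply/andP; move: u; rewrite /= !inE negb_or; case/and3P.
rewrite deriv_cubic !mderivD !mderiv_mulC !expr2 !mderivM !mderivU.
rewrite eqxx nab nac !mpolyC_nat !mulr0n !mulr1n; ring.
Qed.

Lemma deriv11_cubic : F^`M(a)^`M(b) = t%:MP * 'X_c.
Proof.
have [/negbTE nba /negbTE nbc] : b != a /\ b != c.
  apply/andP; move: u; rewrite /= !inE negb_or -andbA => /and3P [nab nac].
  by rewrite andbT => nbc; rewrite eq_sym nab.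
rewrite deriv_cubic !mderivD !mderiv_mulC !expr2 !mderivM !mderivU.
rewrite eqxx nba nbc !mpolyC_nat !mulr0n !mulr1n; ring.
Qed.

End Coordinates.

Lemma tangent_cubic a b c P : uniq [:: a; b; c] ->
  tangent_line F P =
    (3 * P 0 a ^+ 2 + t * (P 0 b * P 0 c))%:MP * 'X_a
    + (3 * P 0 b ^+ 2 + t * (P 0 c * P 0 a))%:MP * 'X_b
    + (3 * P 0 c ^+ 2 + t * (P 0 a * P 0 b))%:MP * 'X_c.
Proof.
move=> u; rewrite /tangent_line (sum3 _ u).
have u' := uniq_rot1 u; have u'' := uniq_rot1 u'.
rewrite (eval_deriv_cubic u) (eval_deriv_cubic u') (eval_deriv_cubic u'').
by rewrite !mul_mpolyC.
Qed.

Lemma point_eq0 a b c P : uniq [:: a; b; c] ->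
  P 0 a = 0 -> P 0 b = 0 -> P 0 c = 0 -> P = 0.
Proof.
move=> u; elim/uniq3P: u => ? ? ?; apply/rowP => i; rewrite mxE;
  by case: (ord3P i) => ->.
Qed.

End Cubic.

(** * Smoothness and the Hessian *)

Section Hesse.
Variables (C : numFieldType) (t : C).
Hypothesis t3 : t ^+ 3 + 27 != 0.
Local Notation F := (cubic_F t).
Implicit Types (P Q : 'rV[C]_3) (a b c : 'I_3).

Lemma natC_neq0 n : n.+1%:R != 0 :> C.
Proof. by rewrite pnatr_eq0. Qed.

Lemma cubic_neq0 : F != 0.
Proof.
have u := uniq012.
apply: (@eval_at_neq0 _ (delta_mx 0 (inord 0))).
rewrite (eval_cubic t u) !mxE !eqxx !inord3_eq /= !(mulr0, mul0r, expr0n, addr0).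
by rewrite expr1n oner_neq0.
Qed.

(** Where the gradient vanishes, 3 x^2 = - t yz and its two permutations multiply to
    (t^3 + 27) (xyz)^2 = 0; then each of the three gives a vanishing cube. *)
Lemma cubic_smooth P : P != 0 -> ~ singular_point F P.
Proof.
have u := uniq012.
have u' := uniq_rot1 u; have u'' := uniq_rot1 u'.
move=> /eqP nP [_ sing]; apply: nP.
have := sing (inord 2); have := sing (inord 1); have := sing (inord 0).
rewrite (eval_deriv_cubic t u) (eval_deriv_cubic t u') (eval_deriv_cubic t u'').
have := @point_eq0 _ _ _ _ P u.
move: (P 0 (inord 0)) (P 0 (inord 1)) (P 0 (inord 2)) => x y z H Ex Ey Ez.
have xyz : x * y * z = 0.
  have : (t ^+ 3 + 27) * (x * y * z) ^+ 2 = 0.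
    transitivity ((3 * x ^+ 2 + t * (y * z)) * (9 * y ^+ 2 * z ^+ 2)
      + - t * (y * z) * (3 * y ^+ 2 + t * (z * x)) * (3 * z ^+ 2)
      + t ^+ 2 * (y * z) * (z * x) * (3 * z ^+ 2 + t * (x * y))); first by ring.
    by rewrite Ex Ey Ez; ring.
  by move/eqP; rewrite mulf_eq0 (negbTE t3) expf_eq0 /= => /eqP.
have cube0 (v w : C) : 3 * v ^+ 2 + t * w = 0 -> v * w = 0 -> v = 0.
  move=> E vw; have : 3 * v ^+ 3 = 0.
    transitivity (v * (3 * v ^+ 2 + t * w) - t * (v * w)); first by ring.
    by rewrite E vw; ring.
  by move/eqP; rewrite mulf_eq0 (negbTE (natC_neq0 2)) expf_eq0 /= => /eqP.
by apply: H; [apply: cube0 Ex _ | apply: cube0 Ey _ | apply: cube0 Ez _];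
  rewrite -xyz; ring.
Qed.

Lemma homog1_deriv2 (N : {mpoly C[3]}) i j : N \is 1.-homog -> N^`M(i)^`M(j) = 0.
Proof.
have hX := @homogX1 C; move=> /(homog1E (hX (inord 0)) (hX (inord 1)) (hX (inord 2))) [].
  exists (fun k => (k == inord 0)%:R), (fun k => (k == inord 1)%:R),
    (fun k => (k == inord 2)%:R) => k.
  by case: (ord3P k) => ->; rewrite !inord3_eq eqxx !scale0r scale1r ?addr0 ?add0r.
move=> v [w [z ->]]; rewrite !mderivD !mderivZ !mderivU.
by rewrite -!mpolyC_nat !mderivC !scaler0 !addr0.
Qed.

(** At a common zero of N and T the second derivatives of F = N G + k T^3 are
    N_i G_j + N_j G_i, a matrix of rank at most 2. Its determinant is the Hessian
    of the cubic, which is 8 (t^3 + 27) xyz modulo F. *)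
Lemma flex_coordinates (N G T : {mpoly C[3]}) k P a b c : uniq [:: a; b; c] ->
  N \is 1.-homog -> F = N * G + k%:MP * T ^+ 3 ->
  eval_at P N = 0 -> eval_at P T = 0 -> P 0 a * P 0 b * P 0 c = 0.
Proof.
move=> u hN EF NP TP.
pose n i := eval_at P N^`M(i); pose g i := eval_at P G^`M(i).
have dN i j : N^`M(i)^`M(j) = 0 by apply: homog1_deriv2.
have hess i j : eval_at P F^`M(i)^`M(j) = n i * g j + n j * g i.
  rewrite EF !exprS expr0 !(mderivD, mderivM, mderivC) dN.
  rewrite !eval_atE NP TP; rewrite /n /g; ring.
have u' := uniq_rot1 u; have u'' := uniq_rot1 u'.
have := hess a b; have := hess b c; have := hess c a.
have := hess a a; have := hess b b; have := hess c c.
rewrite (deriv2_cubic t u) (deriv2_cubic t u') (deriv2_cubic t u'').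
rewrite (deriv11_cubic t u) (deriv11_cubic t u') (deriv11_cubic t u'').
rewrite !eval_atE.
have : eval_at P F = 0 by rewrite EF !eval_atE NP TP; ring.
rewrite (eval_cubic t u).
move: (P 0 a) (P 0 b) (P 0 c) => x y z E0 Ez Ey Ex Eca Ebc Eab.
have : 8 * (t ^+ 3 + 27) * (x * y * z) = 0.
  transitivity ((6 * x) * (6 * y) * (6 * z) + 2 * ((t * z) * (t * x) * (t * y))
   - (6 * x) * (t * x) ^+ 2 - (6 * y) * (t * y) ^+ 2 - (6 * z) * (t * z) ^+ 2
   + 6 * t ^+ 2 * (x ^+ 3 + y ^+ 3 + z ^+ 3 + t * (x * y * z))); first by ring.
  by rewrite E0 Ex Ey Ez Eab Ebc Eca; ring.
by move/eqP; rewrite 2!mulf_eq0 (negbTE t3) (negbTE (natC_neq0 7)) /= => /eqP.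
Qed.

End Hesse.

(** * Flexes, and conics with contact of order six *)

Section Sextactic.
Variables (C : numFieldType) (t : C).
Hypothesis t3 : t ^+ 3 + 27 != 0.
Local Notation F := (cubic_F t).
Implicit Types (P Q : 'rV[C]_3) (a b c : 'I_3).

Lemma cubic_chart P n : P != 0 -> on_curve F P ->
  exists ch : chart F P, [/\ 'X^n %| along (germ ch) F,
    'X^2 %| along (germ ch) (chT ch)
    & exists2 c, c != 0 & tangent_line F P = c *: chT ch].
Proof.
move=> nP FP; apply: (chart_exists n (cubic_homog t)) => //.
- exact: cubic_neq0.
- exact: cubic_smooth.
Qed.

(** If T has order 3 on the arc, the terms of F without T reduce to M^3, so F is a
    combination of T and M^3, and [flex_coordinates] applies with the roles of N
    and T taken by T and M. *)
Lemma flex_on_triangle P a b c : uniq [:: a; b; c] -> P != 0 ->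
  inflection_point F P -> P 0 a * P 0 b * P 0 c = 0.
Proof.
move=> u nP [FP sP m3]; have [ch [dF _ [k nk Etan]]] := cubic_chart 3 nP FP.
move/(intersection_mult_geP (tangent_line_neq0 FP sP) (tangent_line_homog F P) dF): m3.
rewrite Etan alongZ dvdpZr // => dT.
have [hL hM hT] := ch_homog ch; have [EL EM] := ch_along ch.
have [_ MP TP] := ch_eval ch.
have [k0 [k1 [k2 [k3 [k4 [k5 [k6 [k7 [k8 [k9 EF]]]]]]]]]] :=
  homog3E hL hM hT (ch_span ch) (cubic_homog t).
move: dF; have := congr1 (along (germ ch)) EF.
rewrite along_homog3E /= EL EM => ->.
move: dT; set y := along _ _ => dT dF.
have : 'X^3 %| k0%:P + k1%:P * 'X + 'X^2 * (k2%:P + k3%:P * 'X).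
  have -> : k0%:P + k1%:P * 'X + 'X^2 * (k2%:P + k3%:P * 'X) =
    k0%:P * 1 ^+ 3 + k1%:P * (1 ^+ 2 * 'X) + k2%:P * (1 * 'X ^+ 2) +
    k3%:P * 'X ^+ 3 + k4%:P * (1 ^+ 2 * y) + k5%:P * (1 * 'X * y) +
    k6%:P * ('X ^+ 2 * y) + k7%:P * (1 * y ^+ 2) + k8%:P * ('X * y ^+ 2) +
    k9%:P * y ^+ 3 - (k4%:P + k5%:P * 'X + k6%:P * 'X^2 + k7%:P * y
    + k8%:P * ('X * y) + k9%:P * y ^+ 2) * y by ring.
  by apply: dvdp_sub => //; apply: dvdp_mull.
case/dvd_peel => z0 z1; rewrite expr1 -['X]subr0 dvdp_XsubCl /root.
rewrite !hornerE oppr0 mulr0 addr0 => /eqP z2.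
set L := chL ch in EF; set M := chM ch in EF MP hM; set T := chT ch in EF TP hT.
pose G := k4%:MP * L ^+ 2 + k5%:MP * (L * M) + k6%:MP * M ^+ 2
  + k7%:MP * (L * T) + k8%:MP * (M * T) + k9%:MP * T ^+ 2.
apply: (flex_coordinates t3 u hT (G := G) (k := k3) _ TP MP).
by rewrite [LHS]EF z0 z1 z2 mpolyC0 !mul0r !add0r /G; ring.
Qed.

(** The tangent at the flex with coordinates (1, -e, 0) at a, b, c, for a cube
    root of unity e. *)
Definition flex_tangent e a b c : {mpoly C[3]} :=
  3%:MP * ('X_a + (e ^+ 2)%:MP * 'X_b) - (t * e)%:MP * 'X_c.

(** The cofactor of the flex tangent in [hesse_flex_identity]. *)
Definition polar_conic e a b c : {mpoly C[3]} :=
  27%:MP * ('X_a - (e ^+ 2)%:MP * 'X_b) ^+ 2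
  + (3%:MP * ('X_a + (e ^+ 2)%:MP * 'X_b) + (2 * t * e)%:MP * 'X_c) ^+ 2.

Lemma eval_polar_conic e a b c P : eval_at P (polar_conic e a b c) =
  27 * (P 0 a - e ^+ 2 * P 0 b) ^+ 2
  + (3 * (P 0 a + e ^+ 2 * P 0 b) + 2 * t * e * P 0 c) ^+ 2.
Proof.
by rewrite /polar_conic !eval_atE.
Qed.

Lemma eval_flex_tangent e a b c P : eval_at P (flex_tangent e a b c) =
  3 * (P 0 a + e ^+ 2 * P 0 b) - t * e * P 0 c.
Proof.
by rewrite /flex_tangent !eval_atE.
Qed.

(** The substitution Y = e^2 y turns the cubic with parameter t into the one with
    parameter t e, and the cube of t e is the cube of t. *)
Lemma hesse_flex_decomp e a b c : uniq [:: a; b; c] -> e ^+ 3 = 1 ->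
  108%:MP * F = flex_tangent e a b c * polar_conic e a b c
    + (4 * (t ^+ 3 + 27))%:MP * 'X_c ^+ 3.
Proof.
move=> u e3; have E3 : e%:MP ^+ 3 = 1 :> {mpoly C[3]}.
  by rewrite -rmorphXn /= e3 rmorph1.
have := hesse_flex_identity 'X_a ((e ^+ 2)%:MP * 'X_b) 'X_c (t * e)%:MP.
rewrite /= /flex_tangent /polar_conic (cubic_FE t u).
rewrite !(rmorphM, rmorphD, rmorphXn, mpolyC_nat) /=.
move: E3; set E := e%:MP; set T := t%:MP => E3 H.
transitivity (108 * ('X_a ^+ 3 + (E ^+ 2 * 'X_b) ^+ 3 + 'X_c ^+ 3 +
      T * E * ('X_a * (E ^+ 2 * 'X_b) * 'X_c))).
  congr (_ * _); transitivity ('X_a ^+ 3 + (E ^+ 3) ^+ 2 * 'X_b ^+ 3 + 'X_c ^+ 3 +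
      T * E ^+ 3 * ('X_a * 'X_b * 'X_c)); last by ring.
  by rewrite E3; ring.
have -> : T ^+ 3 + 27 = (T * E) ^+ 3 + 27.
  by transitivity (T ^+ 3 * E ^+ 3 + 27); [rewrite E3|]; ring.
rewrite H; ring.
Qed.

(** On z = 0 the tangent at P is a flex tangent N, and N times a conic that does
    not vanish at P is a multiple of z^3 modulo F. *)
Lemma triangle_flex P a b c : uniq [:: a; b; c] -> P != 0 -> on_curve F P ->
  P 0 c = 0 -> inflection_point F P.
Proof.
move=> u nP FP; have [ch [dF dT [k nk Etan]]] := cubic_chart 3 nP FP.
have sP := cubic_smooth t3 nP; move=> Pc; split=> //.
apply/(intersection_mult_geP (tangent_line_neq0 FP sP) (tangent_line_homog F P) dF).
have Ec := FP; rewrite /on_curve (eval_cubic t u) Pc in Ec.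
have nx : P 0 a != 0.
  apply: contraNneq nP => x0; apply/eqP; apply: point_eq0 u (x0) _ (Pc).
  apply/eqP; rewrite -[_ == 0](@expf_eq0 _ _ 3) -Ec x0; apply/eqP; ring.
pose e := - (P 0 b / P 0 a).
have Eb : P 0 b = - (e * P 0 a) by rewrite /e mulNr opprK divfK.
have e3 : e ^+ 3 = 1.
  have : (1 - e ^+ 3) * P 0 a ^+ 3 = 0 by rewrite -[RHS]Ec Eb; ring.
  by move/eqP; rewrite mulf_eq0 expf_eq0 (negbTE nx) orbF subr_eq0 => /eqP.
have Etn : tangent_line F P = (P 0 a ^+ 2)%:MP * flex_tangent e a b c.
  rewrite (tangent_cubic t P u) Pc Eb /flex_tangent.
  rewrite !(rmorphM, rmorphD, rmorphB, rmorphN, rmorphXn, mpolyC_nat, mpolyC0) /=.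
  ring.
rewrite Etn alongM; apply: dvdp_mull.
have nG : eval_at P (polar_conic e a b c) != 0.
  rewrite eval_polar_conic Pc Eb.
  have -> : 27 * (P 0 a - e ^+ 2 * - (e * P 0 a)) ^+ 2
      + (3 * (P 0 a + e ^+ 2 * - (e * P 0 a)) + 2 * t * e * 0) ^+ 2
    = 27 * (P 0 a * (1 + e ^+ 3)) ^+ 2 + (P 0 a * (1 - e ^+ 3)) ^+ 2 * 9 by ring.
  rewrite e3 subrr mulr0 expr0n mul0r addr0.
  by rewrite mulf_neq0 ?(natC_neq0 _ 26) // expf_neq0 // mulf_neq0 ?(natC_neq0 _ 1).
rewrite -(Gauss_dvdpl _ (coprime_along ch 3 nG)) -alongM.
have -> : flex_tangent e a b c * polar_conic e a b c =
    108%:MP * F - (4 * (t ^+ 3 + 27))%:MP * 'X_c ^+ 3.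
  by rewrite (hesse_flex_decomp u e3) addrK.
rewrite alongD alongN 2!alongM alongXn; apply: dvdp_sub; apply: dvdp_mull => //.
by rewrite dvdp_exp2r // Xk_dvd // (along_horner0 _ (ch_germ0 ch)) eval_atX.
Qed.

Section Candidate.
Variables (P : 'rV[C]_3) (a b c : 'I_3).
Hypotheses (u : uniq [:: a; b; c]) (nP : P != 0) (FP : on_curve F P).
Hypothesis cubes : P 0 a ^+ 3 = P 0 b ^+ 3.
Local Notation x := (P 0 a).
Local Notation z := (P 0 c).
Local Notation e := (P 0 b / P 0 a).
Local Notation N := (flex_tangent e a b c).

(* the coefficients in 3 T = al N + be z, see [tangent_candidate] *)
Let al := 3 * x ^+ 2 + t * e * x * z.
Let be := al * t * e + 3 * (3 * z ^+ 2 + t * e * x ^+ 2).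

(** The quotient by N of be^3 (108 F) - 4 (t^3 + 27) (3 T)^3. Both terms are
    4 (t^3 + 27) (be z)^3 modulo N, by [hesse_flex_decomp] and
    [tangent_candidate], so N divides the difference. *)
Definition contact_conic : {mpoly C[3]} :=
  (be ^+ 3)%:MP * polar_conic e a b c
  - (4 * (t ^+ 3 + 27) * al)%:MP * ((al ^+ 2)%:MP * N ^+ 2
     + (3 * al * be)%:MP * (N * 'X_c) + (3 * be ^+ 2)%:MP * 'X_c ^+ 2).

Lemma candidate_xneq0 : x != 0.
Proof.
apply: contraNneq nP => x0; apply/eqP.
have y0 : P 0 b = 0.
  by apply/eqP; rewrite -[_ == 0](@expf_eq0 _ _ 3) -cubes x0 expr0n.
apply: point_eq0 u (x0) (y0) _; move: FP; rewrite /on_curve (eval_cubic t u) x0 y0.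
by rewrite !mul0r mulr0 addr0 expr0n !add0r => /eqP; rewrite expf_eq0 => /eqP.
Qed.
Let nx := candidate_xneq0.

Lemma candidate_e3 : e ^+ 3 = 1.
Proof. by rewrite expr_div_n -cubes divff // expf_neq0. Qed.

Let Eb : P 0 b = e * x.
Proof. by rewrite divfK. Qed.

Lemma candidate_curve : 2 * x ^+ 3 + z ^+ 3 + t * e * x ^+ 2 * z = 0.
Proof.
have := FP; rewrite /on_curve (eval_cubic t u) -cubes.
by rewrite [X in t * (_ * X * _)]Eb => E0; rewrite -[RHS]E0; ring.
Qed.

Lemma tangent_candidate :
  3%:MP * tangent_line F P = al%:MP * N + be%:MP * 'X_c.
Proof.
rewrite (tangent_cubic t P u) /flex_tangent /be /al.
move: candidate_e3 Eb; move: e => d d3 ->.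
move: (P 0 a) (P 0 c) => v w.
have -> : 3 * (d * v) ^+ 2 + t * (w * v) = d ^+ 2 * (3 * v ^+ 2 + t * d * v * w).
  by transitivity (3 * (d * v) ^+ 2 + t * d ^+ 3 * (w * v)); [rewrite d3|]; ring.
have -> : 3%:MP = 3 :> {mpoly C[3]} by rewrite mpolyC_nat.
have Hc (k : C) : (3 * k)%:MP = 3 * k%:MP :> {mpoly C[3]}.
  by rewrite rmorphM /= mpolyC_nat.
have CD (k l : C) : (k + l)%:MP = k%:MP + l%:MP :> {mpoly C[3]} by rewrite mpolyCD.
have CM (k l : C) : (k * l)%:MP = k%:MP * l%:MP :> {mpoly C[3]} by rewrite mpolyCM.
rewrite !(Hc, CD, CM) -!mpolyCM; ring.
Qed.

Lemma tangent_at_candidate : eval_at P N = 6 * x - t * e * z.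
Proof.
rewrite eval_flex_tangent; move: candidate_e3 Eb; move: e => d d3 ->.
by transitivity (3 * (x + d ^+ 3 * x) - t * d * z); [ring | rewrite d3; ring].
Qed.

(** If 6 x = t e z, the equation of the cubic gives z^3 = -8 x^3, and the cube of
    the relation gives t^3 = -27. *)
Lemma tangent_at_candidate_neq0 : eval_at P N != 0.
Proof.
rewrite tangent_at_candidate subr_eq0; apply/eqP => E6.
have := candidate_curve.
have -> : t * e * x ^+ 2 * z = x ^+ 2 * (t * e * z) by ring.
rewrite -E6 => Ez.
have z3 : z ^+ 3 = - 8 * x ^+ 3.
  by apply/eqP; rewrite -subr_eq0 -[X in _ == X]Ez; apply/eqP; ring.
have : 8 * (t ^+ 3 + 27) * x ^+ 3 = 0.
  transitivity ((6 * x) ^+ 3 + t ^+ 3 * (8 * x ^+ 3)); first by ring.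
  rewrite E6 -[8 * _]opprK -mulNr -z3; move: candidate_e3; move: e => d d3.
  by transitivity (t ^+ 3 * z ^+ 3 * (d ^+ 3 - 1)); [ring | rewrite d3; ring].
move/eqP; rewrite 2!mulf_eq0 expf_eq0 (negbTE nx) (negbTE t3).
by rewrite (negbTE (natC_neq0 _ 7)).
Qed.

(** Otherwise the tangent at P would be proportional to N, which does not pass
    through P. *)
Lemma candidate_be_neq0 : be != 0.
Proof.
apply/eqP => be0; have := tangent_candidate; rewrite be0 mpolyC0 mul0r addr0 => E3.
have TP : eval_at P (tangent_line F P) = 0.
  rewrite (tangent_cubic t P u) !eval_atE; have := FP.
  rewrite /on_curve (eval_cubic t u) => E0.
  by rewrite -[RHS](mulr0 3) -E0; ring.
have al0 : al = 0.
  have := congr1 (eval_at P) E3; rewrite 2!eval_atM TP mulr0 eval_atC => /esym/eqP.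
  by rewrite mulf_eq0 (negbTE tangent_at_candidate_neq0) orbF => /eqP.
move/eqP: E3; rewrite al0 mpolyC0 mul0r mulf_eq0 mpolyC_eq0 (negbTE (natC_neq0 _ 2)).
by apply/negP/(tangent_line_neq0 FP)/cubic_smooth.
Qed.

Lemma contact_identity : N * contact_conic = (108 * be ^+ 3)%:MP * F
  - (4 * (t ^+ 3 + 27))%:MP * (3%:MP * tangent_line F P) ^+ 3.
Proof.
rewrite tangent_candidate mulrBr.
have -> : N * ((be ^+ 3)%:MP * polar_conic e a b c) =
   (be ^+ 3)%:MP * (108%:MP * F - (4 * (t ^+ 3 + 27))%:MP * 'X_c ^+ 3).
  by rewrite (hesse_flex_decomp u candidate_e3) addrK; ring.
move: (4 * (t ^+ 3 + 27)) al be (F) (N) ('X_c : {mpoly C[3]}) => k a1 b1 f n w.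
rewrite !(mpolyCM, rmorphXn, mpolyC_nat) /=; ring.
Qed.

Lemma contact_conic_homog : contact_conic \is 2.-homog.
Proof.
have hX := @homogX1 C.
have hS : 'X_a + (e ^+ 2)%:MP * 'X_b \is 1.-homog by rewrite dhomogD ?homogCM.
have hD : 'X_a - (e ^+ 2)%:MP * 'X_b \is 1.-homog by rewrite homogB ?homogCM.
have hN : N \is 1.-homog by rewrite homogB ?homogCM.
have hG : polar_conic e a b c \is 2.-homog.
  by rewrite dhomogD ?homogCM ?homog1X // dhomogD ?homogCM.
have hNX : N * 'X_c \is 2.-homog by apply: (@dhomogM _ _ _ 1 _ 1).
by rewrite homogB ?homogCM // !dhomogD ?homogCM ?homog1X.
Qed.

(** At the point (1, -e, 0) the forms N and z vanish and only be^3 times the value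
    of the polar conic remains. *)
Lemma contact_conic_neq0 : contact_conic != 0.
Proof.
pose Q : 'rV[C]_3 := \row_i ((i == a)%:R - (i == b)%:R * e).
have [/negbTE nab /negbTE nac /negbTE nbc] : [/\ a != b, a != c & b != c].
  by move: u; rewrite /= !inE negb_or andbT -andbA => /and3P.
apply: (@eval_at_neq0 _ Q).
have [Qa Qb Qc] : [/\ Q 0 a = 1, Q 0 b = - e & Q 0 c = 0].
  rewrite !mxE !eqxx nab [b == a]eq_sym nab [c == a]eq_sym nac [c == b]eq_sym nbc.
  by rewrite !(mul0r, mul1r, subr0, sub0r).
have e3 := candidate_e3.
have QN : eval_at Q N = 0.
  rewrite eval_flex_tangent Qa Qb Qc; move: e e3 => d d3.
  by transitivity (3 * (1 - d ^+ 3)); [ring | rewrite d3; ring].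
rewrite /contact_conic; move: (eval_polar_conic e a b c Q) QN.
move: (polar_conic e a b c) N => K n EK QN.
rewrite !eval_atE QN EK Qa Qb Qc.
set r := _ - _; have -> : r = be ^+ 3 * 108.
  rewrite /r; move: e e3 be al => d d3 b1 a1.
  transitivity (b1 ^+ 3 * (27 * (1 + d ^+ 3) ^+ 2 + (3 * (1 - d ^+ 3)) ^+ 2)).
    by ring.
  by rewrite d3; ring.
by rewrite mulf_neq0 ?(natC_neq0 _ 107) // expf_neq0 // candidate_be_neq0.
Qed.

(** N G is a combination of F and T^3, both of order at least 6 on the arc, and N
    does not vanish at P. *)
Lemma candidate_sextactic : sextactic_point F P.
Proof.
have sP := cubic_smooth t3 nP.
have [ch [dF dT [k nk Etan]]] := cubic_chart 6 nP FP.
have dG : 'X^6 %| along (germ ch) contact_conic.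
  rewrite -(Gauss_dvdpr _ (coprime_along ch 6 tangent_at_candidate_neq0)) -alongM.
  rewrite contact_identity Etan alongD alongN 2!alongM alongXn [along _ (3%:MP * _)]alongM.
  apply: dvdp_sub; apply: dvdp_mull => //.
  have -> : 'X^6 = ('X^2) ^+ 3 :> {poly C} by rewrite -exprM.
  apply: dvdp_exp2r.
  by apply: dvdp_mull; rewrite alongZ dvdpZr.
have hG := contact_conic_homog; have nG := contact_conic_neq0.
have dvd5 p : 'X^6 %| p -> 'X^5 %| (p : {poly C}).
  by apply: dvdp_trans; rewrite dvdp_exp2l.
split=> // [fl|].
  have := flex_on_triangle u nP fl => /eqP.
  rewrite 2!mulf_eq0 (negbTE nx) {1}Eb mulf_eq0 (negbTE nx) orbF -orbA.
  have ne : e != 0 by apply: contra_eq_neq candidate_e3 => ->; rewrite expr0n eq_sym oner_neq0.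
  rewrite (negbTE ne) /= => /eqP z0; have := candidate_curve.
  rewrite z0 expr0n mulr0 !addr0 => /eqP; rewrite mulf_eq0 expf_eq0.
  by rewrite (negbTE nx) (negbTE (natC_neq0 _ 1)).
exists contact_conic; first split=> //.
  by apply/(intersection_mult_geP nG hG (dvd5 _ dF)); apply: dvd5.
by apply/(intersection_mult_geP nG hG dF).
Qed.

End Candidate.

End Sextactic.

(** * Sextactic points have two coordinates with equal cubes *)

Section Necessity.
Variables (C : numFieldType) (t : C).
Hypothesis t3 : t ^+ 3 + 27 != 0.
Local Notation F := (cubic_F t).
Implicit Types (P Q : 'rV[C]_3) (a b c : 'I_3).

(** On the arc the monomials L^2, LM, M^2, LT, MT, T^2 have the orders
    0, 1, 2, 2, 3, 4. In a conic of order 6 the first two are absent, and M^2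
    must be present, because without it the remaining orders are distinct. *)
Lemma conic_normal_form (L M T G : {mpoly C[3]}) (g : 'I_3 -> {poly C}) y :
  L \is 1.-homog -> M \is 1.-homog -> T \is 1.-homog ->
  (exists a b c : 'I_3 -> C,
    forall i, 'X_i = a i *: L + b i *: M + c i *: T) ->
  along g L = 1 -> along g M = 'X -> along g T = y * 'X^2 -> y.[0] != 0 ->
  G != 0 -> G \is 2.-homog -> 'X^6 %| along g G ->
  exists k d e f : C, k != 0 /\
    G = k%:MP * (M ^+ 2 + d%:MP * (L * T) + e%:MP * (M * T) + f%:MP * T ^+ 2).
Proof.
move=> hL hM hT hX EL EM ET ny nG hG dG.
have [k0 [k1 [k2 [k3 [k4 [k5 EG]]]]]] := homog2E hL hM hT hX hG.
move: dG nG; rewrite EG along_homog2E EL EM ET => dG nG.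
have : 'X^6 %| k0%:P + k1%:P * 'X
    + 'X^2 * (k2%:P + y * (k3%:P + k4%:P * 'X + 'X^2 * (k5%:P * y))).
  by move: dG; congr (_ %| _); ring.
case/dvd_peel => z0 z1 d4.
have nk2 : k2 != 0.
  apply: contraNneq nG => z2; move: d4; rewrite z2 add0r => /(dvd_cancel ny).
  case/dvd_peel => z3 z4; rewrite mulrC => /(dvd_cancel ny).
  rewrite -[k5%:P]addr0 -[X in _ + X](mulr0 'X^2) -[k5%:P]addr0.
  rewrite -[X in _ + X + _](mul0r 'X) -polyC0 => /(@dvd_peel _ 0) [z5 _ _].
  by rewrite z0 z1 z3 z4 z5 !mpolyC0 !mul0r !addr0.
exists k2, (k3 / k2), (k4 / k2), (k5 / k2); split=> //.
have K (k : C) : k%:MP = k2%:MP * (k / k2)%:MP :> {mpoly C[3]}.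
  by rewrite -mpolyCM mulrC divfK.
by rewrite z0 z1 (K k3) (K k4) (K k5) mpolyC0; ring.
Qed.

(** Subtracting from F the multiples of L G, M G, T G that cancel L M^2, M^3 and
    M^2 T leaves the monomials L^3, L^2 M, L^2 T, LMT, L T^2, M T^2, T^3, whose
    orders on the arc are 0 to 6. As F and G have order at least 6, only T^3 can
    remain. *)
Lemma cubic_pencil (L M T G : {mpoly C[3]}) (g : 'I_3 -> {poly C}) y d e f :
  L \is 1.-homog -> M \is 1.-homog -> T \is 1.-homog ->
  (exists a b c : 'I_3 -> C,
    forall i, 'X_i = a i *: L + b i *: M + c i *: T) ->
  along g L = 1 -> along g M = 'X -> along g T = y * 'X^2 -> y.[0] != 0 ->
  G = M ^+ 2 + d%:MP * (L * T) + e%:MP * (M * T) + f%:MP * T ^+ 2 ->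
  'X^6 %| along g G -> 'X^6 %| along g F ->
  exists N (k : C), N \is 1.-homog /\ F = N * G + k%:MP * T ^+ 3.
Proof.
move=> hL hM hT hX EL EM ET ny EG dG dF.
have [k0 [k1 [k2 [k3 [k4 [k5 [k6 [k7 [k8 [k9 EF]]]]]]]]]] :=
  homog3E hL hM hT hX (cubic_homog t).
pose n3 := k6 - k3 * e.
pose N := k2%:MP * L + k3%:MP * M + n3%:MP * T.
pose c4 := k4 - k2 * d; pose c5 := k5 - k2 * e - k3 * d.
pose c7 := k7 - k2 * f - n3 * d; pose c8 := k8 - k3 * f - n3 * e.
pose c9 := k9 - n3 * f.
have hN : N \is 1.-homog by rewrite !dhomogD ?homogCM.
have ER : F = N * G + (k0%:MP * L ^+ 3 + k1%:MP * (L ^+ 2 * M)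
    + 0%:MP * (L * M ^+ 2) + 0%:MP * M ^+ 3
    + c4%:MP * (L ^+ 2 * T) + c5%:MP * (L * M * T) + 0%:MP * (M ^+ 2 * T)
    + c7%:MP * (L * T ^+ 2) + c8%:MP * (M * T ^+ 2) + c9%:MP * T ^+ 3).
  rewrite EF EG /N /c4 /c5 /c7 /c8 /c9 /n3 !(mpolyCB, mpolyCM, mpolyC0).
  rewrite ?(mpolyCB, mpolyCM); ring.
have : 'X^6 %| k0%:P + k1%:P * 'X + 'X^2 * (y * (c4%:P + c5%:P * 'X
    + 'X^2 * (y * (c7%:P + c8%:P * 'X + 'X^2 * (c9%:P * y))))).
  have := congr1 (along g) ER; rewrite (alongD g (N * G)) (alongM g N) along_homog3E.
  rewrite /= EL EM ET.
  move=> E.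
  suff -> : k0%:P + k1%:P * 'X + 'X^2 * (y * (c4%:P + c5%:P * 'X
    + 'X^2 * (y * (c7%:P + c8%:P * 'X + 'X^2 * (c9%:P * y))))) =
      along g F - along g N * along g G.
    by apply: dvdp_sub => //; apply: dvdp_mull.
  by rewrite E polyC0; ring.
case/dvd_peel => z0 z1 /(dvd_cancel ny); case/dvd_peel => z4 z5.
move=> /(dvd_cancel ny); case/dvd_peel => z7 z8 _.
exists N, c9; split=> //.
by rewrite [LHS]ER z0 z1 z4 z5 z7 z8 mpolyC0 !mul0r !add0r.
Qed.

(** The point Q is the residual intersection of the tangent at P with the cubic.
    In F = N G + k T^3, evaluated at Q, the conic G reduces to M^2. If M(Q) = 0,
    then Q is proportional to P, which makes the differences of the cubes equal,
    and hence zero as they add up to zero. Otherwise N(Q) = 0, so Q is a flex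
    and one of its coordinates vanishes. *)
Lemma sextactic_cubes P a b c : uniq [:: a; b; c] -> P != 0 ->
  sextactic_point F P ->
  [\/ P 0 a ^+ 3 = P 0 b ^+ 3, P 0 b ^+ 3 = P 0 c ^+ 3 | P 0 c ^+ 3 = P 0 a ^+ 3].
Proof.
move=> u nP [FP sP nfl [G [[nG hG] _] m6]].
have u' := uniq_rot1 u; have u'' := uniq_rot1 u'.
have nz : P 0 c != 0 by apply/eqP => /(triangle_flex t3 u nP FP).
have nx : P 0 a != 0 by apply/eqP => /(triangle_flex t3 u' nP FP).
have ny : P 0 b != 0 by apply/eqP => /(triangle_flex t3 u'' nP FP).
have [ch [dF /dvdpP [y Ey] [k nk Etan]]] := cubic_chart t3 6 nP FP.
have ny0 : y.[0] != 0.
  apply/eqP => y0; apply: nfl; split=> //.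
  have dF3 : 'X^3 %| along (germ ch) F by apply: dvdp_trans dF; rewrite dvdp_exp2l.
  apply/(intersection_mult_geP (tangent_line_neq0 FP sP) (tangent_line_homog F P) dF3).
  rewrite Etan alongZ dvdpZr // Ey exprS; apply: dvdp_mul => //; exact: Xk_dvd.
move/(intersection_mult_geP nG hG dF): m6 => dG.
have [hL hM hT] := ch_homog ch; have [EL EM] := ch_along ch.
have [LP MP TP] := ch_eval ch.
have [k' [d [e [f [nk' EG]]]]] :=
  conic_normal_form hL hM hT (ch_span ch) EL EM Ey ny0 nG hG dG.
move: dG; rewrite EG alongM alongC mul_polyC dvdpZr //; set G0 := (X in along _ X) => dG.
have [N [k1 [hN EF]]] := cubic_pencil hL hM hT (ch_span ch) EL EM Ey ny0 erefl dG dF.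
pose A := P 0 a ^+ 3; pose B := P 0 b ^+ 3; pose D := P 0 c ^+ 3.
pose Q : 'rV[C]_3 := \row_i (if i == a then P 0 a * (B - D)
  else if i == b then P 0 b * (D - A) else P 0 c * (A - B)).
have [/negbTE nba /negbTE nca /negbTE ncb] : [/\ b != a, c != a & c != b].
  move: u; rewrite /= !inE negb_or andbT -andbA => /and3P [? ? ?].
  by split; rewrite eq_sym.
have Qa : Q 0 a = P 0 a * (B - D) by rewrite mxE eqxx.
have Qb : Q 0 b = P 0 b * (D - A) by rewrite mxE nba eqxx.
have Qc : Q 0 c = P 0 c * (A - B) by rewrite mxE nca ncb.
have E0 : P 0 a ^+ 3 + P 0 b ^+ 3 + P 0 c ^+ 3 + t * (P 0 a * P 0 b * P 0 c) = 0.
  by rewrite -(eval_cubic t u).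
have TQ : eval_at Q (chT ch) = 0.
  have := congr1 (eval_at Q) Etan; rewrite eval_atZ (tangent_cubic t P u) !eval_atE.
  rewrite Qa Qb Qc /A /B /D => /esym/eqP.
  rewrite (_ : _ + _ = 0); last by ring.
  by rewrite mulf_eq0 (negbTE nk) => /eqP.
have FQ : eval_at Q F = 0.
  rewrite (eval_cubic t u) Qa Qb Qc.
  transitivity ((A - B) * (B - D) * (D - A) * (P 0 a ^+ 3 + P 0 b ^+ 3 + P 0 c ^+ 3
    + t * (P 0 a * P 0 b * P 0 c))); first by rewrite /A /B /D; ring.
  by rewrite E0 mulr0.
have G0Q : eval_at Q G0 = eval_at Q (chM ch) ^+ 2.
  by rewrite /G0 !eval_atE TQ; ring.
have /eqP : eval_at Q N * eval_at Q (chM ch) ^+ 2 = 0.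
  have EV (A1 A2 : {mpoly C[3]}) : eval_at Q (A1 * A2 + k1%:MP * chT ch ^+ 3)
      = eval_at Q A1 * eval_at Q A2 + k1 * eval_at Q (chT ch) ^+ 3.
    by rewrite !eval_atE.
  have := congr1 (eval_at Q) EF; rewrite FQ EV TQ G0Q expr0n mulr0 addr0.
  by move=> <-.
rewrite mulf_eq0 expf_eq0 /= => /orP [/eqP NQ|/eqP MQ].
  have := flex_coordinates t3 u hN EF NQ TQ; rewrite Qa Qb Qc => /eqP.
  rewrite !mulf_eq0 (negbTE nx) (negbTE ny) (negbTE nz) /= !subr_eq0 -orbA.
  by case/or3P => /eqP; [apply: Or32 | apply: Or33 | apply: Or31].
have [a0 [b0 [c0 hX]]] := ch_span ch.
have PQ i : Q 0 i = P 0 i * eval_at Q (chL ch).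
  have := congr1 (eval_at P) (hX i); have := congr1 (eval_at Q) (hX i).
  by rewrite !eval_atE LP MP TP TQ MQ !mulr0 !addr0 mulr1 => -> ->.
have := PQ a; have := PQ b; have := PQ c; rewrite Qa Qb Qc.
move=> /(mulfI nz) Ec /(mulfI ny) Eb /(mulfI nx) Ea.
apply: Or31; apply/eqP; rewrite -subr_eq0 -/A -/B Ec.
have : 3 * eval_at Q (chL ch) = 0.
  by transitivity ((A - B) + (D - A) + (B - D)); [rewrite Ea Eb Ec|]; ring.
by move/eqP; rewrite mulf_eq0 (negbTE (natC_neq0 _ 2)).
Qed.

End Necessity.

(** * The 27 points *)

Section Candidates.
Variable C : numClosedFieldType.
Local Notation eps := (eps C).

Lemma eps2 : eps ^+ 2 = eps - 1.
Proof.
have n2 : (2 : C) != 0 by exact: (natC_neq0 _ 1).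
rewrite /Defs.eps expr_div_n sqrrD expr1n mul1r exprMn sqrCi sqrtCK.
by field.
Qed.

Lemma eps3 : eps ^+ 3 = -1.
Proof. by rewrite exprSr eps2 mulrBl -expr2 eps2; ring. Qed.

Local Notation w := (eps ^+ 2).

Lemma omega_rel : w ^+ 2 + w + 1 = 0.
Proof. by rewrite eps2 sqrrB eps2; ring. Qed.

Lemma omega_cube : w ^+ 3 = 1.
Proof. by rewrite exprAC eps3 sqrrN expr1n. Qed.

Lemma omega_neq1 : w != 1.
Proof.
apply/eqP => w1; have /eqP := omega_rel; rewrite w1 expr1n.
by rewrite (_ : _ + _ = 3%:R) ?pnatr_eq0 //; ring.
Qed.

Lemma omega3 k : (eps ^+ (2 * k)) ^+ 3 = 1.
Proof. by rewrite exprM exprAC omega_cube expr1n. Qed.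

Lemma omega_powers (e : C) : e ^+ 3 = 1 -> exists k : 'I_3, e = eps ^+ (2 * k).
Proof.
move=> e3; have : (e - 1) * ((e - w) * (e - w ^+ 2)) = 0.
  transitivity ((e - 1) * (e ^+ 2 + w ^+ 3 - (w ^+ 2 + w + 1) * e + e)).
    by ring.
  rewrite omega_rel omega_cube.
  by transitivity (e ^+ 3 - 1); [ring | rewrite e3 subrr].
move=> /eqP; rewrite !mulf_eq0 !subr_eq0 => /or3P [] /eqP ->.
- by exists (inord 0); rewrite inordK // muln0 expr0.
- by exists (inord 1); rewrite inordK // muln1.
- by exists (inord 2); rewrite inordK // -exprM.
Qed.

Lemma omega_inj (k k' : 'I_3) : eps ^+ (2 * k) = eps ^+ (2 * k') -> k = k'.
Proof.
have nw1 := omega_neq1.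
have nw2 : w ^+ 2 != 1.
  apply: contra_neq omega_neq1 => w2.
  by have := omega_cube; rewrite exprS w2 mulr1.
have nww : w ^+ 2 != w.
  apply: contra_neq nw2 => w2; have := omega_cube.
  by rewrite exprSr w2 -expr2 w2.
by case: (ord3P k) => ->; case: (ord3P k') => -> //; rewrite !inordK // => /eqP;
  rewrite ?muln0 ?muln1 ?(exprM _ 2 2) ?expr0 ?[1 == _]eq_sym
  ?(negbTE nw1) ?(negbTE nw2) ?(negbTE nww) // eq_sym (negbTE nww).
Qed.

Section Roots.
Variables (t a : C).
Hypotheses (t0 : t != 0) (t3 : t ^+ 3 + 27 != 0).
Hypothesis ha : 27 * (a ^+ 3) * (a ^+ 3 + 2) = t ^+ 3.

Lemma a_neq0 : a != 0.
Proof.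
apply: contraNneq t0 => a0.
by rewrite -[_ == 0](@expf_eq0 _ _ 3) -ha a0 expr0n mulr0 mul0r.
Qed.

Section Fixed.
Variable k : 'I_3.
Local Notation e := (eps ^+ (2 * k)).
Let v := - (e * t / (3 * a)).

Lemma cardano_product : 3 * a * v = - (e * t).
Proof. by rewrite /v; field; exact: a_neq0. Qed.

Lemma cardano_sum : a ^+ 3 + v ^+ 3 = - 2.
Proof.
have n3 : 27 * a ^+ 3 != 0 by rewrite mulf_neq0 ?(natC_neq0 _ 26) // expf_neq0 // a_neq0.
apply: (mulfI n3); transitivity (27 * a ^+ 6 + (3 * a * v) ^+ 3); first by ring.
rewrite cardano_product exprNn exprMn omega3 mul1r -ha; ring.
Qed.

Lemma z_solE j : z_sol t a k j = [:: a + v; w * a + w ^+ 2 * v; w ^+ 2 * a + w * v]`_j.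
Proof.
have e5 : eps ^+ 5 = - w by rewrite (exprD _ 3 2) eps3 mulN1r.
have e4 : w ^+ 2 = - eps by rewrite -exprM (exprD _ 3 1) eps3 mulN1r.
rewrite /z_sol (exprD _ _ 1) (exprD _ _ 5) e5 e4 expr1 /v.
by case: j => [[|[|[|//]]] ?] /=; ring.
Qed.

(** Cardano's factorization, with 3 a v = - e t and a^3 + v^3 = -2. *)
Lemma z_sol_poly z :
  z ^+ 3 + e * t * z + 2 = (z - z_sol t a k (inord 0)) * (z - z_sol t a k (inord 1))
   * (z - z_sol t a k (inord 2)).
Proof.
rewrite !z_solE !inordK //=.
have -> : e * t = - (3 * a * v) by rewrite cardano_product opprK.
have -> : 2 = - (a ^+ 3 + v ^+ 3) by rewrite cardano_sum opprK.
have -> : (z - (w * a + w ^+ 2 * v)) = z - w * a - w ^+ 2 * v by ring.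
transitivity ((z - (a + v)) * (z ^+ 2 + (a + v) * z + (a ^+ 2 + v ^+ 2 - a * v))).
  by ring.
rewrite -mulrA; congr (_ * _).
transitivity (z ^+ 2 - (w ^+ 2 + w + 1) * ((a + v) * z - a * v) + (a + v) * z
  + (w ^+ 3 * (a ^+ 2 + v ^+ 2) + (w ^+ 3 - 1) * (w * a * v)- a * v)).
  by rewrite omega_rel omega_cube; ring.
by ring.
Qed.

Lemma z_sol_rootP z :
  z ^+ 3 + e * t * z + 2 = 0 <-> exists j, z = z_sol t a k j.
Proof.
rewrite z_sol_poly; split=> [/eqP|[j ->]].
  by rewrite !mulf_eq0 !subr_eq0 -orbA => /or3P [] /eqP ->; eexists.
by case: (ord3P j) => ->; rewrite subrr !(mul0r, mulr0).
Qed.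

(** If a^3 = v^3, both are -1, and the discriminant t^3 + 27 is zero. *)
Lemma cardano_cubes_neq : a ^+ 3 != v ^+ 3.
Proof.
apply: contra_neq t3 => av; have := cardano_sum; rewrite -av => a3.
have n4 : (4 : C) != 0 by exact: (natC_neq0 _ 3).
apply: (mulfI n4); rewrite mulr0 -ha.
transitivity (27 * (a ^+ 3 + a ^+ 3 + 2) ^+ 2); first by ring.
by rewrite a3 addNr expr0n mulr0.
Qed.

Lemma z_sol_inj : injective (z_sol t a k).
Proof.
have [n0 n1 n2] : [/\ a - v != 0, a - w * v != 0 & a - w ^+ 2 * v != 0].
  apply/and3P; rewrite -!negb_or -!mulf_eq0.
  have -> : (a - v) * ((a - w * v) * (a - w ^+ 2 * v)) = a ^+ 3 - v ^+ 3.
    transitivity (a ^+ 3 - w ^+ 3 * v ^+ 3 - (w ^+ 2 + w + 1) *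
       (a ^+ 2 * v) + (w ^+ 2 + w + w ^+ 3) * a * v ^+ 2); first by ring.
    by rewrite omega_cube omega_rel; ring.
  by rewrite subr_eq0 cardano_cubes_neq.
have nw := omega_neq1; have nw2 : w ^+ 2 != 1.
  apply: contra_neq nw => w2; by have := omega_cube; rewrite exprS w2 mulr1.
have nw0 : w != 0.
  by apply: contra_eq_neq omega_cube => ->; rewrite expr0n eq_sym oner_neq0.
have n01 : (z_sol t a k (inord 0) == z_sol t a k (inord 1)) = false.
  apply/negbTE; rewrite -subr_eq0 !z_solE !inordK //=.
  have -> : a + v - (w * a + w ^+ 2 * v)
    = (1 - w) * (a - w ^+ 2 * v) + (1 - w ^+ 3) * v by ring.
  by rewrite omega_cube subrr mul0r addr0 mulf_neq0 // subr_eq0 eq_sym.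
have n02 : (z_sol t a k (inord 0) == z_sol t a k (inord 2)) = false.
  apply/negbTE; rewrite -subr_eq0 !z_solE !inordK //=.
  have -> : a + v - (w ^+ 2 * a + w * v)
    = (1 - w ^+ 2) * (a - w * v) + (1 - w ^+ 3) * v by ring.
  by rewrite omega_cube subrr mul0r addr0 mulf_neq0 // subr_eq0 eq_sym.
have n12 : (z_sol t a k (inord 1) == z_sol t a k (inord 2)) = false.
  apply/negbTE; rewrite -subr_eq0 !z_solE !inordK //=.
  have -> : w * a + w ^+ 2 * v - (w ^+ 2 * a + w * v) = w * (1 - w) * (a - v) by ring.
  by apply: mulf_neq0 => //; apply: mulf_neq0 => //; rewrite subr_eq0 eq_sym.
move=> j j' /eqP; case: (ord3P j) => ->; case: (ord3P j') => -> //;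
  by rewrite ?n01 ?n02 ?n12 // eq_sym ?n01 ?n02 ?n12.
Qed.

End Fixed.

(** If z^3 = 1, then e t z = -3, whose cube is t^3 = -27. Geometrically, no point of
    the curve has three coordinates with equal cubes. *)
Lemma z_sol_cube_neq1 k j : z_sol t a k j ^+ 3 != 1.
Proof.
have /z_sol_rootP : exists j', z_sol t a k j = z_sol t a k j' by exists j.
move: (z_sol t a k j) => z Ez; apply: contra_neq t3 => z3.
have Ez' : eps ^+ (2 * k) * t * z = - 3.
  by apply/eqP; rewrite -subr_eq0 -[X in _ == X]Ez z3; apply/eqP; ring.
move: (eps ^+ _) (omega3 k) Ez' => e e3 E.
transitivity (e ^+ 3 * t ^+ 3 * z ^+ 3 + 27); first by rewrite e3 z3; ring.
by transitivity ((e * t * z) ^+ 3 + 27); [ring | rewrite E; ring].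
Qed.

(** In the m-th family the coordinates at cand_a m and cand_b m have equal cubes, the
    former is 1, and z_j is the coordinate at cand_c m. *)
Definition cand_a (m : 'I_3) : 'I_3 := inord (nth 0%N [:: 0; 0; 2] m).
Definition cand_b (m : 'I_3) : 'I_3 := inord (nth 0%N [:: 1; 2; 1] m).
Definition cand_c (m : 'I_3) : 'I_3 := inord (nth 0%N [:: 2; 1; 0] m).

Lemma cand_uniq m : uniq [:: cand_a m; cand_b m; cand_c m].
Proof.
by case: (ord3P m) => ->; rewrite /cand_a /cand_b /cand_c inordK //= !inE !inord3_eq.
Qed.

Local Notation cand := (sextactic_candidate t a).

Lemma candE m k j : [/\ cand m k j 0 (cand_a m) = 1,
  cand m k j 0 (cand_b m) = eps ^+ (2 * k) & cand m k j 0 (cand_c m) = z_sol t a k j].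
Proof.
rewrite /sextactic_candidate /cand_a /cand_b /cand_c.
by case: (ord3P m) => ->; rewrite !inordK //= !mxE !inordK.
Qed.

Lemma cand_ext (P Q : 'rV[C]_3) m : P 0 (cand_a m) = Q 0 (cand_a m) ->
  P 0 (cand_b m) = Q 0 (cand_b m) -> P 0 (cand_c m) = Q 0 (cand_c m) -> P = Q.
Proof.
move=> Ea Eb Ec; apply/eqP; rewrite -subr_eq0; apply/eqP.
by apply: (point_eq0 (cand_uniq m)); rewrite !mxE ?Ea ?Eb ?Ec subrr.
Qed.

Lemma sextactic_candidates P : P != 0 ->
  sextactic_point (cubic_F t) P <-> exists m k j, proj_eq (cand m k j) P.
Proof.
move=> nP; split=> [sx|[m [k [j [l nl EP]]]]].
  have FP : on_curve (cubic_F t) P by case: sx.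
  have [m Em] : exists m, P 0 (cand_a m) ^+ 3 = P 0 (cand_b m) ^+ 3.
    have u := uniq012.
    case: (sextactic_cubes t3 u nP sx) => E.
    - by exists (inord 0); rewrite /cand_a /cand_b inordK.
    - by exists (inord 2); rewrite /cand_a /cand_b inordK.
    - by exists (inord 1); rewrite /cand_a /cand_b inordK.
  have u := cand_uniq m; have nx := candidate_xneq0 u nP FP Em.
  have [k Ek] := omega_powers (candidate_e3 u nP FP Em).
  have := candidate_curve u nP FP Em; rewrite Ek => Ec.
  have /z_sol_rootP [j Ej] : (P 0 (cand_c m) / P 0 (cand_a m)) ^+ 3
      + eps ^+ (2 * k) * t * (P 0 (cand_c m) / P 0 (cand_a m)) + 2 = 0.
    rewrite -(mul0r (P 0 (cand_a m) ^- 3)) -Ec.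
    by move: nx; move: (P 0 _) (P 0 _) (eps ^+ _) => z x e nx; field.
  exists m, k, j, (P 0 (cand_a m)) => //.
  have [Ca Cb Cc] := candE m k j.
  apply: (@cand_ext _ _ m); rewrite mxE ?Ca ?Cb ?Cc ?mulr1 //.
    by rewrite -Ek mulrC divfK.
  by rewrite -Ej mulrC divfK.
have [Ca Cb Cc] := candE m k j.
have Pa : P 0 (cand_a m) = l by rewrite EP mxE Ca mulr1.
have Pb : P 0 (cand_b m) = l * eps ^+ (2 * k) by rewrite EP mxE Cb.
have Pc : P 0 (cand_c m) = l * z_sol t a k j by rewrite EP mxE Cc.
have /z_sol_rootP Ez : exists j', z_sol t a k j = z_sol t a k j' by exists j.
apply: (candidate_sextactic t3 (cand_uniq m) nP).
  rewrite /on_curve (eval_cubic t (cand_uniq m)) Pa Pb Pc.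
  rewrite -(mulr0 (l ^+ 3)) -Ez [(l * eps ^+ _) ^+ 3]exprMn omega3; ring.
by rewrite Pa Pb exprMn omega3 mulr1.
Qed.

(** The cube of a coordinate of a candidate is 1 except at cand_c m, so a scalar
    multiple determines the family, and then the coordinate 1 fixes the scalar. *)
Lemma candidates_distinct m k j m' k' j' :
  proj_eq (cand m k j) (cand m' k' j') -> [/\ m = m', k = k' & j = j'].
Proof.
move=> [l nl E]; have Ei i : cand m' k' j' 0 i = l * cand m k j 0 i.
  by rewrite E mxE.
have cube1 m0 k0 j0 i : (cand m0 k0 j0 0 i ^+ 3 == 1) = (i != cand_c m0).
  have [Ca Cb Cc] := candE m0 k0 j0; have := cand_uniq m0.
  rewrite /= !inE negb_or andbT -andbA => /and3P [_ nac nbc].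
  have [->|->|->] := uniq3_cases (cand_uniq m0) i.
  - by rewrite Ca expr1n eqxx nac.
  - by rewrite Cb omega3 eqxx nbc.
  - by rewrite Cc eqxx (negbTE (z_sol_cube_neq1 _ _)).
have Em : m = m'.
  have [Ec|nc] := eqVneq (cand_c m) (cand_c m').
    move: Ec; rewrite /cand_c; case: (ord3P m) => ->; case: (ord3P m') => -> //;
      by rewrite !inordK //= => /eqP; rewrite !inord3_eq.
  have [i /andP [ni ni']] : exists i, (i != cand_c m) && (i != cand_c m').
    case: (ord3P (cand_c m)) => ->; case: (ord3P (cand_c m')) => ->;
      solve [ by exists (inord 0); rewrite !inord3_eq
            | by exists (inord 1); rewrite !inord3_eq
            | by exists (inord 2); rewrite !inord3_eq ].
  have l3 : l ^+ 3 = 1.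
    have E1 : cand m k j 0 i ^+ 3 = 1 by apply/eqP; rewrite cube1.
    have E2 : cand m' k' j' 0 i ^+ 3 = 1 by apply/eqP; rewrite cube1.
    by rewrite -E2 Ei exprMn E1 mulr1.
  have := cube1 m' k' j' (cand_c m); rewrite Ei exprMn l3 mul1r cube1 eqxx nc.
  by [].
have [Ca Cb Cc] := candE m k j; have [Ca' Cb' Cc'] := candE m' k' j'.
rewrite -Em in Ca' Cb' Cc' Ei.
have l1 : l = 1 by have := Ei (cand_a m); rewrite Ca Ca' mulr1.
have Ek : k = k'.
  by apply: omega_inj; have := Ei (cand_b m); rewrite Cb Cb' l1 mul1r.
split=> //; rewrite -Ek in Cc' Ei; apply: (@z_sol_inj k).
by have := Ei (cand_c m); rewrite Cc Cc' l1 mul1r.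
Qed.

End Roots.
End Candidates.

Theorem mainTheorem4 (R : realType) (t : R[i])
  (t_neq0 : t != 0) (t3_neq : t ^+ 3 + 27 != 0)
  (* the choice of the roots in a(t): s is a square root of t^3 + 27, c and w
     are cube roots of 3 and of sqrt 3 * s - 9 *)
  (s c w : R[i])
  (hs : s ^+ 2 = t ^+ 3 + 27)
  (hc : c ^+ 3 = 3)
  (hw : w ^+ 3 = sqrtC 3 * s - 9) :
  let a := c * w / 3 in
  [/\ (* the z_j are the three solutions of z^3 + eps^(2k) t z + 2 = 0 *)
      forall k : 'I_3,
        injective (z_sol t a k) /\
        forall z : R[i],
          z ^+ 3 + eps _ ^+ (2 * k) * t * z + 2 = 0
          <-> exists j : 'I_3, z = z_sol t a k j,
      (* the sextactic points are exactly the listed points *)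
      forall P : 'rV[R[i]]_3, P != 0 ->
        (sextactic_point (cubic_F t) P
         <-> exists m k j : 'I_3, proj_eq (sextactic_candidate t a m k j) P)
    & (* the listed 27 points are pairwise distinct *)
      forall m k j m' k' j' : 'I_3,
        proj_eq (sextactic_candidate t a m k j)
                (sextactic_candidate t a m' k' j') ->
        [/\ m = m', k = k' & j = j']].
Proof.
move=> a.
have ha : 27 * a ^+ 3 * (a ^+ 3 + 2) = t ^+ 3.
  have n3 : (3 : R[i]) != 0 by exact: (natC_neq0 _ 2).
  have -> : a ^+ 3 = (sqrtC 3 * s - 9) / 9.
    rewrite -hw; transitivity (c ^+ 3 * w ^+ 3 / 27); first by rewrite /a; field.
    by rewrite hc; field.
  transitivity ((sqrtC 3 ^+ 2 * s ^+ 2 - 81) / 3); first by field.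
  by rewrite sqrtCK hs; field.
split=> [k|P nP|m k j m' k' j'].
- by split; [exact: z_sol_inj | exact: z_sol_rootP].
- exact: sextactic_candidates.
- exact: candidates_distinct.
Qed.
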